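(* If $\mathbb{F}$ is a field and $\Gamma$ is a finite digraph whose cycles are pairwise disjoint, then $GKdim\, L_{\mathbb{F}}(\Gamma)=ht(\Gamma)$.
   Context: A digraph $\Gamma=(V,E,s,t)$ has vertex set $V$, arrow set $E$, and source and target maps $s,t:E\to V$ (written $se$, $te$). It is finite if $V$ and $E$ are finite. A sink is a vertex $v$ with $s^{-1}(v)=\emptyset$. A path of length $n>0$ is a sequence $p=e_1\cdots e_n$ of arrows with $te_i=se_{i+1}$; a path of length 0 is a vertex. A cycle is a path $C=e_1\cdots e_n$ with $n>0$, $sC=tC$ and $se_i\neq se_j$ for $i\neq j$; cycles differing by cyclic rotation are identified. An exit of $C$ is an arrow $e$ with $se=se_i$ and $e\neq e_i$ for some $i$. Cycles are pairwise disjoint if distinct cycles have no common vertex. For vertices, $u\leadsto v$ means there is a path from $u$ to $v$. When cycles are pairwise disjoint this induces a partial order $\leadsto$ on the set of sinks and cycles of $\Gamma$ ($x\leadsto y$ if there is a path from a vertex of $x$ to a vertex of $y$). Height: the height of a sink is 0; the height of a cycle with no exit is 1; the height of a cycle $C$ with an exit is defined recursively by $ht(C)=2+\max\{ht(x)\mid C\leadsto x,\ x\neq C\}$ (with $x$ ranging over sinks and cycles). The height $ht(\Gamma)$ is the maximum of the heights of the cycles of $\Gamma$, or 0 if $\Gamma$ has no cycles. The Leavitt path algebra $L_{\mathbb{F}}(\Gamma)$ is the $\mathbb{F}$-algebra generated by $V\sqcup E\sqcup E^*$, where $E^*=\{e^*: e\in E\}$ with $s(e^* )=te$, $t(e^*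 )=se$, subject to: (V) $vw=\delta_{v,w}v$ for $v,w\in V$; (E) $(se)e=e=e(te)$ for $e\in E\sqcup E^*$; (CK1) $e^*f=\delta_{e,f}\,te$ for $e,f\in E$; (CK2) $v=\sum_{se=v}ee^*$ for all $v\in V$ with $0<|s^{-1}(v)|<\infty$. For $\Gamma$ finite it is finitely generated with $1=\sum_{v\in V}v$. For a finitely generated $\mathbb{F}$-algebra $A$ with 1, $GKdim\,A=\limsup_{n\to\infty}\frac{\log(\dim W^n)}{\log n}$, where $W$ is a finite dimensional $\mathbb{F}$-subspace generating $A$ with $1\in W$, and $W^n$ is the $\mathbb{F}$-span of $n$-fold products of elements of $W$ (the value is independent of $W$). *)

(* Defs.v *)
From HB Require Import structures.
From mathcomp Require Import all_boot all_order all_algebra.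
From mathcomp Require Import all_classical all_reals all_analysis.

Set Implicit Arguments.
Unset Strict Implicit.
Unset Printing Implicit Defensive.

Import Order.TTheory GRing.Theory Num.Theory.
Local Open Scope ring_scope.
Local Open Scope quotient_scope.

(** * Algebras and Gelfand-Kirillov dimension *)

(* Unital associative algebras.  [algType] excludes the zero algebra, which is
   the Leavitt path algebra of the digraph without vertices. *)
HB.mixin Record Lmodule_isUAlgebra (F : fieldType) A of GRing.Lmodule F A := {
  uone : A;
  umul : A -> A -> A;
  umulA : associative umul;
  umul1l : left_id uone umul;
  umul1r : right_id uone umul;
  umulDl : left_distributive umul +%R;
  umulDr : right_distributive umul +%R;
  uscaleAl : forall (a : F) (x y : A), a *: umul x y = umul (a *: x) y;
  uscaleAr : forall (a : F) (x y : A), a *: umul x y = umul x (a *: y)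
}.

#[short(type="ualgType")]
HB.structure Definition UAlgebra (F : fieldType) :=
  {A of GRing.Lmodule F A & Lmodule_isUAlgebra F A}.

Section GelfandKirillov.
Local Open Scope classical_set_scope.
Variables (F : fieldType) (A : ualgType F).
Implicit Types (S W U : set A) (n : nat).

Definition lspan S : set A :=
  [set x | exists n (a : 'I_n -> F) (u : 'I_n -> A),
     (forall i, S (u i)) /\ x = \sum_(i < n) a i *: u i].

Definition lin_indep n (b : 'I_n -> A) : Prop :=
  forall a : 'I_n -> F, \sum_(i < n) a i *: b i = 0 -> forall i, a i = 0.

(* The dimension of a subspace; junk value 0 if there is no finite basis. *)
Definition ldim U : nat :=
  xget 0%N [set n | exists b : 'I_n -> A, lin_indep b /\ lspan (range b) = U].

Definition findim_subspace W : Prop :=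
  exists n (u : 'I_n -> A), W = lspan (range u).

Definition generates W : Prop :=
  forall B : {pred A},
    [/\ uone \in B, linear_closed B & {in B &, forall x y, umul x y \in B}] ->
    (forall x, W x -> x \in B) -> forall x, x \in B.

Definition gk_frame W : Prop := [/\ findim_subspace W, W uone & generates W].

Definition powspan W n : set A :=
  lspan [set x | exists w : 'I_n -> A,
           (forall i, W (w i)) /\ x = \big[umul/uone]_(i < n) w i].

(* The finitely many terms with n <= 1 are junk and irrelevant.  For the zero
   algebra all dimensions are 0 and [ln 0 = 0], so that the value is 0. *)
Definition gk_limsup (R : realType) W : \bar R :=
  limn_esup (fun n => (ln (ldim (powspan W n))%:R / ln n%:R)%:E).

(* The algebra is finitely generated and d is its Gelfand-Kirillov dimension,
   whichever generating subspace is used to compute it. *)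
Definition has_GKdim (R : realType) (d : \bar R) : Prop :=
  (exists W, gk_frame W) /\ (forall W, gk_frame W -> gk_limsup R W = d).

End GelfandKirillov.
Arguments has_GKdim {F} A {R} d.

(** * Not necessarily unital algebras given by generators and relations *)

Inductive term (F : fieldType) (X : Type) : Type :=
| TGen of X
| TZero
| TAdd of term F X & term F X
| TScale of F & term F X
| TMul of term F X & term F X.
Arguments TGen {F X} x.
Arguments TZero {F X}.

HB.instance Definition _ (F : fieldType) (X : Type) := gen_eqMixin (term F X).
HB.instance Definition _ (F : fieldType) (X : Type) :=
  gen_choiceMixin (term F X).

(* The least congruence that contains [rel] and makes the quotient an
   associative, not necessarily unital, F-algebra. *)
Inductive congr (F : fieldType) (X : Type) (rel : term F X -> term F X -> Prop) :
    term F X -> term F X -> Prop :=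
| congr_rel x y of rel x y : congr rel x y
| congr_refl x : congr rel x x
| congr_sym x y of congr rel x y : congr rel y x
| congr_trans y x z of congr rel x y & congr rel y z : congr rel x z
| congr_add x x' y y' of congr rel x x' & congr rel y y' :
    congr rel (TAdd x y) (TAdd x' y')
| congr_scale a x x' of congr rel x x' : congr rel (TScale a x) (TScale a x')
| congr_mul x x' y y' of congr rel x x' & congr rel y y' :
    congr rel (TMul x y) (TMul x' y')
| congr_addA x y z : congr rel (TAdd x (TAdd y z)) (TAdd (TAdd x y) z)
| congr_addC x y : congr rel (TAdd x y) (TAdd y x)
| congr_add0 x : congr rel (TAdd TZero x) x
| congr_addN x : congr rel (TAdd (TScale (-1) x) x) TZero
| congr_scaleA a b x : congr rel (TScale a (TScale b x)) (TScale (a * b) x)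
| congr_scale1 x : congr rel (TScale 1 x) x
| congr_scaleDr a x y :
    congr rel (TScale a (TAdd x y)) (TAdd (TScale a x) (TScale a y))
| congr_scaleDl a b x :
    congr rel (TScale (a + b) x) (TAdd (TScale a x) (TScale b x))
| congr_mulA x y z : congr rel (TMul x (TMul y z)) (TMul (TMul x y) z)
| congr_mulDl x y z :
    congr rel (TMul (TAdd x y) z) (TAdd (TMul x z) (TMul y z))
| congr_mulDr x y z :
    congr rel (TMul x (TAdd y z)) (TAdd (TMul x y) (TMul x z))
| congr_scaleAl a x y : congr rel (TScale a (TMul x y)) (TMul (TScale a x) y)
| congr_scaleAr a x y : congr rel (TScale a (TMul x y)) (TMul x (TScale a y)).

Section Presentation.
Variables (F : fieldType) (X : Type) (rel : term F X -> term F X -> Prop).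

Definition congrb (x y : term F X) : bool := `[< congr rel x y >].

Lemma congrb_equiv : equiv_class_of congrb.
Proof.
split=> [x|x y|y x z].
- exact/asboolP/congr_refl.
- by apply/asboolP/asboolP; apply: congr_sym.
- by move=> /asboolP xy /asboolP yz; apply/asboolP; apply: congr_trans xy yz.
Qed.

Canonical congrb_equiv_rel := EquivRelPack congrb_equiv.

Definition presented : Type := {eq_quot congrb}.
HB.instance Definition _ := Choice.copy presented {eq_quot congrb}.

Definition pcls (t : term F X) : presented := \pi_{eq_quot congrb} t.
Definition prep (x : presented) : term F X := repr (x : {eq_quot congrb}).

Lemma prepK : cancel prep pcls.
Proof. exact: reprK. Qed.

Lemma pclsP t u : pcls t = pcls u <-> congr rel t u.
Proof.
by split=> [/(@eqquotP _ congrb_equiv_rel {eq_quot congrb})/asboolP|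
  /asboolP/(@eqquotP _ congrb_equiv_rel {eq_quot congrb})].
Qed.

Lemma prep_cls t : congr rel (prep (pcls t)) t.
Proof. by apply/pclsP; rewrite prepK. Qed.

Definition padd (x y : presented) : presented := pcls (TAdd (prep x) (prep y)).
Definition pscale (a : F) (x : presented) : presented := pcls (TScale a (prep x)).
Definition pmul (x y : presented) : presented := pcls (TMul (prep x) (prep y)).

Lemma paddE t u : padd (pcls t) (pcls u) = pcls (TAdd t u).
Proof. by apply/pclsP; apply: congr_add; apply: prep_cls. Qed.

Lemma pscaleE a t : pscale a (pcls t) = pcls (TScale a t).
Proof. by apply/pclsP; apply: congr_scale; apply: prep_cls. Qed.

Lemma pmulE t u : pmul (pcls t) (pcls u) = pcls (TMul t u).
Proof. by apply/pclsP; apply: congr_mul; apply: prep_cls. Qed.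

Lemma pcls_ind (P : presented -> Prop) : (forall t, P (pcls t)) -> forall x, P x.
Proof. by move=> Pcls x; rewrite -[x]prepK. Qed.

Lemma paddA : associative padd.
Proof.
elim/pcls_ind=> x; elim/pcls_ind=> y; elim/pcls_ind=> z.
by rewrite !paddE; apply/pclsP/congr_addA.
Qed.

Lemma paddC : commutative padd.
Proof.
by elim/pcls_ind=> x; elim/pcls_ind=> y; rewrite !paddE; apply/pclsP/congr_addC.
Qed.

Lemma padd0 : left_id (pcls TZero) padd.
Proof. by elim/pcls_ind=> x; rewrite paddE; apply/pclsP/congr_add0. Qed.

Lemma paddN : left_inverse (pcls TZero) (pscale (-1)) padd.
Proof. by elim/pcls_ind=> x; rewrite pscaleE paddE; apply/pclsP/congr_addN. Qed.

HB.instance Definition _ := GRing.isZmodule.Build presented paddA paddC padd0 paddN.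

Lemma pcls_add t u : pcls t + pcls u = pcls (TAdd t u).
Proof. exact: paddE. Qed.

Lemma pscaleA a b x : pscale a (pscale b x) = pscale (a * b) x.
Proof.
by elim/pcls_ind: x => x; rewrite !pscaleE; apply/pclsP/congr_scaleA.
Qed.

Lemma pscale1 : left_id 1 pscale.
Proof. by elim/pcls_ind=> x; rewrite pscaleE; apply/pclsP/congr_scale1. Qed.

Lemma pscaleDr : right_distributive pscale +%R.
Proof.
move=> a; elim/pcls_ind=> x; elim/pcls_ind=> y.
rewrite pcls_add !pscaleE pcls_add.
exact/pclsP/congr_scaleDr.
Qed.

Lemma pscaleDl x : {morph pscale^~ x : a b / a + b}.
Proof.
elim/pcls_ind: x => x a b.
rewrite !pscaleE pcls_add; exact/pclsP/congr_scaleDl.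
Qed.

HB.instance Definition _ :=
  GRing.Zmodule_isLmodule.Build F presented pscaleA pscale1 pscaleDr pscaleDl.

Lemma pcls_scale a t : a *: pcls t = pcls (TScale a t).
Proof. exact: pscaleE. Qed.

Lemma pmulA : associative pmul.
Proof.
elim/pcls_ind=> x; elim/pcls_ind=> y; elim/pcls_ind=> z.
by rewrite !pmulE; apply/pclsP/congr_mulA.
Qed.

Lemma pmulDl : left_distributive pmul +%R.
Proof.
elim/pcls_ind=> x; elim/pcls_ind=> y; elim/pcls_ind=> z.
rewrite pcls_add !pmulE pcls_add.
exact/pclsP/congr_mulDl.
Qed.

Lemma pmulDr : right_distributive pmul +%R.
Proof.
elim/pcls_ind=> x; elim/pcls_ind=> y; elim/pcls_ind=> z.
rewrite pcls_add !pmulE pcls_add.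
exact/pclsP/congr_mulDr.
Qed.

Lemma pscaleAl a x y : a *: pmul x y = pmul (a *: x) y.
Proof.
elim/pcls_ind: x => x; elim/pcls_ind: y => y.
rewrite !(pmulE, pcls_scale).
exact/pclsP/congr_scaleAl.
Qed.

Lemma pscaleAr a x y : a *: pmul x y = pmul x (a *: y).
Proof.
elim/pcls_ind: x => x; elim/pcls_ind: y => y.
rewrite !(pmulE, pcls_scale).
exact/pclsP/congr_scaleAr.
Qed.

End Presentation.

(** * Finite digraphs *)

Record digraph := Digraph {
  vertex : finType;
  arrow : finType;
  src : arrow -> vertex;
  tgt : arrow -> vertex
}.

Section Digraph.
Variable G : digraph.
Implicit Types (u v : vertex G) (e f : arrow G) (C D : {set arrow G}).

Definition sink v : bool := [forall e : arrow G, src e != v].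

(* [cycle] also closes up the sequence: the target of the last arrow is the
   source of the first. *)
Definition is_cycle (c : seq (arrow G)) : bool :=
  [&& c != [::], cycle (fun e f => tgt e == src f) c & uniq (map (@src G) c)].

(* A cycle up to rotation is represented by its set of arrows: since sources do
   not repeat, this set determines the cyclic order (see [is_cycle_rot]). *)
Definition cycles : {set {set arrow G}} :=
  [set C | `[< exists2 c, is_cycle c & C = [set e in c] >]].

Definition cycle_vertices C : {set vertex G} := [set src e | e in C].

Definition has_exit C : bool :=
  [exists e, [exists f in C, (src e == src f) && (e != f)]].

Definition disjoint_cycles : Prop :=
  {in cycles &, forall C D, C != D ->
     [disjoint cycle_vertices C & cycle_vertices D]}.

Definition reach : rel (vertex G) :=
  connect (fun u v => [exists e, (src e == u) && (tgt e == v)]).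

(* Sinks and cycles together. *)
Definition node : finType := (vertex G + {set arrow G})%type.

Definition nodes : {set node} :=
  [set x | match x with inl v => sink v | inr C => C \in cycles end].

Definition node_vertices (x : node) : {set vertex G} :=
  match x with inl v => [set v] | inr C => cycle_vertices C end.

Definition leads (x y : node) : bool :=
  [exists u in node_vertices x, [exists v in node_vertices y, reach u v]].

(* The recursion for the height, with fuel [k]. *)
Fixpoint height_rec (k : nat) (x : node) : nat :=
  match k, x with
  | k'.+1, inr C =>
      if has_exit C
      then (2 + \max_(y in nodes | leads x y && (y != x)) height_rec k' y)%N
      else 1%N
  | _, _ => 0%N
  end.

(* When the cycles are pairwise disjoint, [leads] is a partial order on [nodes],
   so the fuel suffices (see [height_cycle]). *)
Definition height (x : node) : nat := height_rec #|nodes| x.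

Definition digraph_height : nat := \max_(C in cycles) height (inr C).


Lemma uniq_src_inj (c : seq (arrow G)) :
  uniq (map (@src G) c) -> {in c &, injective (@src G)}.
Proof.
elim: c => [|x c IHc] //= /andP[xc uc] e f; rewrite !inE.
case/predU1P=> [->|ec]; case/predU1P=> [->|fc] // ef.
- by rewrite ef map_f in xc.
- by rewrite -ef map_f in xc.
- exact: IHc ef.
Qed.

Lemma path_src_inj C x p q : {in C &, injective (@src G)} ->
  {subset p <= C} -> {subset q <= C} -> size p = size q ->
  path (fun e f => tgt e == src f) x p -> path (fun e f => tgt e == src f) x q ->
  p = q.
Proof.
move=> injC; elim: p x q => [|y p IHp] x [|z q] //= pC qC [pq].
move=> /andP[/eqP xy yp] /andP[/eqP xz zq].
have yz : y = z.
  by apply: (injC y z); [apply: pC|apply: qC|rewrite -xy]; rewrite ?mem_head.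
rewrite -yz in zq *; congr cons; apply: IHp pq yp zq => t tp.
- by apply: pC; rewrite inE tp orbT.
- by apply: qC; rewrite inE tp orbT.
Qed.

Lemma rot_is_cycle k c : is_cycle c -> is_cycle (rot k c).
Proof.
by rewrite /is_cycle rot_cycle map_rot rot_uniq -!size_eq0 size_rot.
Qed.

Lemma is_cycle_rot c d : is_cycle c -> is_cycle d ->
  [set e in c]%SET = [set e in d]%SET -> exists k, d = rot k c.
Proof.
move=> cc cd cdE.
have mE : c =i d by move=> e; move/setP/(_ e): cdE; rewrite !inE.
case: d cd cdE mE => [|x q] cd cdE mE; first by case/andP: cd.
have xc : x \in c by rewrite mE mem_head.
have [i p cE] := rot_to xc; exists i; rewrite cE; congr cons.
have := rot_is_cycle i cc; rewrite cE => cp.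
have pE : x :: p =i x :: q by move=> e; rewrite -cE mem_rot mE.
case/and3P: cp => _; rewrite [cycle _ _]/= => pp up.
case/and3P: cd => _; rewrite [cycle _ _]/= => pq uq.
have spq : size q = size p.
  have := uniq_size_uniq (map_uniq up) pE.
  by rewrite (map_uniq uq) => /esym/eqP[].
apply: (@path_src_inj [set e in x :: q] x) spq _ _.
- move=> e f; rewrite !inE => ex fx; rewrite -!in_cons in ex fx.
  exact: (uniq_src_inj uq).
- by move=> e eq; rewrite !inE eq orbT.
- by move=> e ep; rewrite inE -pE inE ep orbT.
- by move: pq; rewrite rcons_path => /andP[].
- by move: pp; rewrite rcons_path => /andP[].
Qed.

Lemma cyclesP C :
  reflect (exists2 c, is_cycle c & C = [set e in c]%SET) (C \in cycles).
Proof. by rewrite inE; apply: (iffP (asboolP _)). Qed.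

Lemma cycle_next C e : C \in cycles -> e \in C -> tgt e \in cycle_vertices C.
Proof.
case/cyclesP=> c cc ->; rewrite inE => ec.
have [i p cE] := rot_to ec; have := rot_is_cycle i cc; rewrite cE.
case/and3P=> _; rewrite [cycle _ _]/= => ep _.
suff [f fc ->] : exists2 f, f \in c & tgt e = src f by rewrite imset_f ?inE.
have {}cE f : (f \in c) = (f \in e :: p) by rewrite -cE mem_rot.
case: p ep cE => [|f p] /= /andP[/eqP ef _] cE.
- by exists e; rewrite ?cE ?inE ?eqxx.
- by exists f; rewrite ?cE ?inE ?eqxx ?orbT.
Qed.

Lemma path_reach e p f : path (fun e f => tgt e == src f) e p ->
  f \in e :: p -> reach (src e) (src f).
Proof.
elim: p e => [|g p IHp] e /=; first by rewrite inE => _ /eqP->; apply: connect0.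
case/andP=> /eqP eg gp; rewrite inE => /predU1P[->|fp]; first exact: connect0.
apply: connect_trans (IHp _ gp fp); apply: connect1.
by apply/existsP; exists e; rewrite eg !eqxx.
Qed.

Lemma cycle_connected C : C \in cycles ->
  {in cycle_vertices C &, forall u v, reach u v}.
Proof.
case/cyclesP=> c cc -> u v /imsetP[e ec ->] /imsetP[f fc ->].
rewrite !inE in ec fc.
have [i p cE] := rot_to ec; have := rot_is_cycle i cc; rewrite cE.
case/and3P=> _; rewrite [cycle _ _]/= rcons_path => /andP[ep _] _.
by apply: (path_reach ep); rewrite -cE mem_rot.
Qed.

Lemma lift_path u p : path (fun u v => [exists e, (src e == u) && (tgt e == v)]) u p ->
  exists c, [/\ map (@src G) c = belast u p, map (@tgt G) c = p &
    forall e, tgt e = u -> path (fun e f => tgt e == src f) e c].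
Proof.
elim: p u => [|v p IHp] u /=; first by exists [::].
case/andP=> /existsP[e /andP[/eqP eu /eqP ev]] /IHp[c [cs ct cp]].
exists (e :: c); split=> /=; rewrite ?eu ?ev ?cs ?ct // => f fu.
by rewrite fu eqxx cp.
Qed.

Lemma cycle_return C u v w : disjoint_cycles -> C \in cycles ->
  u \in cycle_vertices C -> w \in cycle_vertices C ->
  reach u v -> reach v w -> v \in cycle_vertices C.
Proof.
move=> dj CC uC wC /connectP[p + vE] vw; rewrite {}vE in vw *.
elim: p u uC vw => [|t p IHp] u uC //= vw /andP[/existsP[e /andP[/eqP eu /eqP et]] tp].
have [tC|tnC] := boolP (t \in cycle_vertices C); first exact: IHp vw tp.
have tu : reach t u.
  apply: connect_trans (cycle_connected CC wC uC).
  by apply: connect_trans vw; apply/connectP; exists p.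
have /connectP[q + uE] := tu; rewrite {}uE in uC eu *; move=> tq; move: tq uC eu.
case/shortenP=> q' tq' uq' _ {q} uC eu.
have [c [cs ct cp]] := lift_path tq'.
have ec : is_cycle (e :: c).
  apply/and3P; split=> //=.
  - rewrite rcons_path cp // eu -et -(last_map (@tgt G)) ct et eqxx. by [].
  - by rewrite cs eu; move: uq'; rewrite lastI rcons_uniq.
have DC : [set f in e :: c]%SET \in cycles by apply/cyclesP; exists (e :: c).
have [DE|CD] := eqVneq C [set f in e :: c]%SET.
  by rewrite DE -et cycle_next // inE mem_head in tnC.
have /pred0P/(_ (src e)) := dj _ _ CC DC CD.
by rewrite /= eu uC -eu imset_f // inE mem_head.
Qed.

Lemma nodesE (x : node) : (x \in nodes) =
  match x with inl v => sink v | inr C => C \in cycles end.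
Proof. by rewrite inE. Qed.

Lemma sink_reach v w : sink v -> reach v w -> w = v.
Proof.
move=> /forallP sv /connectP[[|u p] //= /andP[/existsP[e /andP[ev _]] _]].
by rewrite (negPf (sv e)) in ev.
Qed.

Lemma node_connected x : x \in nodes ->
  {in node_vertices x &, forall u v, reach u v}.
Proof.
case: x => [v|C]; rewrite inE; last exact: cycle_connected.
by move=> _ u w /set1P-> /set1P->; apply: connect0.
Qed.

Lemma leads_refl : {in nodes, reflexive leads}.
Proof.
move=> x xn; suff [u ux] : exists u, u \in node_vertices x.
  apply/existsP; exists u; rewrite ux; apply/existsP; exists u; rewrite ux.
  exact: connect0.
case: x xn => [v|C]; first by exists v; apply: set11.
rewrite inE => /cyclesP[[|e c] cc ->]; first by case/andP: cc.
by exists (src e); rewrite imset_f // inE mem_head.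
Qed.

Lemma leadsP x y : reflect (exists u v,
  [/\ u \in node_vertices x, v \in node_vertices y & reach u v]) (leads x y).
Proof.
apply: (iffP existsP) => [[u /andP[ux /existsP[v /andP[vy uv]]]]|[u [v [ux vy uv]]]].
  by exists u, v.
by exists u; rewrite ux; apply/existsP; exists v; rewrite vy.
Qed.

Lemma leads_trans y x z : y \in nodes -> leads x y -> leads y z -> leads x z.
Proof.
move=> yn /leadsP[u [v [ux vy uv]]] /leadsP[v' [w [v'y wz vw]]].
apply/leadsP; exists u, w; split=> //; apply: connect_trans uv _.
by apply: connect_trans vw; apply: (node_connected yn).
Qed.

Lemma leads_anti : disjoint_cycles -> {in nodes &, antisymmetric leads}.
Proof.
move=> dj x y xn yn /andP[/leadsP[u [v [ux vy uv]]] /leadsP[v' [u' [v'y u'x vu]]]].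
have {v'y}vu : reach v u' by apply: connect_trans vu; apply: (node_connected yn).
case: x y xn yn ux vy u'x => [a|C] [b|D]; rewrite !nodesE /= => xn yn.
- move: xn yn => sa _ /set1P ua /set1P vb _; rewrite ua vb in uv.
  by rewrite (sink_reach sa uv).
- move: xn yn => sa DD /set1P ua vD _; rewrite {}ua in uv.
  case/imsetP: vD => e eD vE; rewrite (sink_reach sa uv) in vE.
  by move/forallP/(_ e): sa; rewrite vE eqxx.
- move: xn yn => CC sb uC /set1P vb u'C; rewrite {}vb in vu.
  case/imsetP: u'C => e eD vE; rewrite (sink_reach sb vu) in vE.
  by move/forallP/(_ e): sb; rewrite vE eqxx.
- move: xn yn => CC DD uC vD u'C.
  have vC := cycle_return dj CC uC u'C uv vu.
  have [->//|/(dj _ _ CC DD)/pred0P/(_ v)] := eqVneq C D.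
  by rewrite /= vC vD.
Qed.

Lemma mem_down x : x \in nodes -> x \in [set y in nodes | leads x y]%SET.
Proof. by move=> xn; rewrite finset.in_set xn leads_refl. Qed.

Lemma height_rec_stable k m x : disjoint_cycles -> x \in nodes ->
  (#|[set y in nodes | leads x y]%SET| <= k)%N ->
  (#|[set y in nodes | leads x y]%SET| <= m)%N ->
  height_rec k x = height_rec m x.
Proof.
move=> dj; elim: k m x => [|k IHk] [|m] x xn //=;
  have xx := mem_down xn;
  rewrite ?leqn0 ?cards_eq0 => k0 m0.
- by rewrite (eqP k0) inE in xx.
- by rewrite (eqP m0) inE in xx.
case: x xn xx k0 m0 => // C xn xx k0 m0; case: ifP => // _; congr (_ + _)%N.
apply: eq_bigr => y /and3P[yn xy yx].
suff lt : (#|[set z in nodes | leads y z]%SET| <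
           #|[set z in nodes | leads (inr C) z]%SET|)%N.
  by apply: IHk yn _ _; rewrite -ltnS; apply: leq_trans lt _.
apply/proper_card/properP; split.
  apply/fintype.subsetP=> z; rewrite 2!finset.in_set => /andP[-> yz] /=.
  exact: leads_trans xy yz.
exists (inr C); first exact: xx.
rewrite finset.in_set; apply/negP=> /andP[_ yC]; case/eqP: yx; apply: leads_anti => //.
by rewrite yC xy.
Qed.

Lemma height_cycle C : disjoint_cycles -> C \in cycles ->
  height (inr C) =
    if has_exit C
    then (2 + \max_(y in nodes | leads (inr C) y && (y != inr C)) height y)%N
    else 1%N.
Proof.
move=> dj CC; have Cn : (inr C : node) \in nodes by rewrite inE.
rewrite /height (@height_rec_stable _ #|nodes|.+1) //=.
- by apply: subset_leq_card; apply/fintype.subsetP=> y; rewrite inE => /andP[].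
- apply: leqW; apply: subset_leq_card; apply/fintype.subsetP=> y; rewrite inE.
  by case/andP.
Qed.

End Digraph.
Arguments digraph_height : clear implicits.
Arguments disjoint_cycles : clear implicits.

(** * Leavitt path algebras *)

Section Leavitt.
Variables (F : fieldType) (G : digraph).

Inductive generator : Type :=
| Vert of vertex G
| Arr of arrow G
| Star of arrow G.

Notation vt v := (TGen (Vert v) : term F generator).
Notation ar e := (TGen (Arr e) : term F generator).
Notation st e := (TGen (Star e) : term F generator).

Inductive leavitt_rel : term F generator -> term F generator -> Prop :=
| lpa_V v w : leavitt_rel (TMul (vt v) (vt w)) (if v == w then vt v else TZero)
| lpa_src e : leavitt_rel (TMul (vt (src e)) (ar e)) (ar e)
| lpa_tgt e : leavitt_rel (TMul (ar e) (vt (tgt e))) (ar e)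
| lpa_src_star e : leavitt_rel (TMul (vt (tgt e)) (st e)) (st e)
| lpa_tgt_star e : leavitt_rel (TMul (st e) (vt (src e))) (st e)
| lpa_CK1 e f :
    leavitt_rel (TMul (st e) (ar f)) (if e == f then vt (tgt e) else TZero)
| lpa_CK2 v of ~~ sink v :
    leavitt_rel (vt v)
      (foldr (@TAdd F generator) TZero
         [seq TMul (ar e) (st e) | e <- enum (arrow G) & src e == v]).

Definition leavitt : Type := presented leavitt_rel.
HB.instance Definition _ := GRing.Lmodule.on leavitt.

Definition lmul : leavitt -> leavitt -> leavitt := @pmul _ _ leavitt_rel.
Definition lvert (v : vertex G) : leavitt := pcls leavitt_rel (vt v).
(* No unit is adjoined: the sum of the vertices is one, by the relations. *)
Definition lone : leavitt := \sum_(v : vertex G) lvert v.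

Let lmulA : associative lmul := @pmulA _ _ leavitt_rel.

Let mul0x x : lmul 0 x = 0.
Proof. by apply: (addIr (lmul 0 x)); rewrite -pmulDl !add0r. Qed.

Let mulx0 x : lmul x 0 = 0.
Proof. by apply: (addIr (lmul x 0)); rewrite -pmulDr !add0r. Qed.

Let mul_suml x : lmul lone x = \sum_(v : vertex G) lmul (lvert v) x.
Proof. exact: (big_morph (lmul^~ x) (fun a b => pmulDl a b x) (mul0x x)). Qed.

Let mul_sumr x : lmul x lone = \sum_(v : vertex G) lmul x (lvert v).
Proof. exact: (big_morph (lmul x) (fun a b => pmulDr x a b) (mulx0 x)). Qed.

Let relE x y : leavitt_rel x y -> pcls leavitt_rel x = pcls leavitt_rel y.
Proof. by move=> xy; apply/pclsP/congr_rel. Qed.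

Let vert_mul v w : lmul (lvert v) (lvert w) = if v == w then lvert v else 0.
Proof. by rewrite [LHS]pmulE (relE (lpa_V _ _)); case: eqP. Qed.

Let lone_absl v x : lmul (lvert v) x = x -> lmul lone x = x.
Proof.
move=> vx; rewrite mul_suml (bigD1 v) //= vx big1 ?addr0 // => w wv.
by rewrite -vx lmulA vert_mul (negPf wv) mul0x.
Qed.

Let lone_absr v x : lmul x (lvert v) = x -> lmul x lone = x.
Proof.
move=> xv; rewrite mul_sumr (bigD1 v) //= xv big1 ?addr0 // => w wv.
by rewrite -xv -lmulA vert_mul eq_sym (negPf wv) mulx0.
Qed.

Lemma lmul1l : left_id lone lmul.
Proof.
elim/pcls_ind; elim=> [[v|e|e]||x IHx y IHy|a x IHx|x IHx y IHy].
- by apply: (@lone_absl v); rewrite vert_mul eqxx.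
- by apply: (@lone_absl (src e)); rewrite [LHS]pmulE; apply/relE/lpa_src.
- by apply: (@lone_absl (tgt e)); rewrite [LHS]pmulE; apply/relE/lpa_src_star.
- exact: mulx0.
- by rewrite -pcls_add [LHS]pmulDr; congr (_ + _).
- by rewrite -pcls_scale -[LHS]pscaleAr; congr (_ *: _).
- by rewrite -pmulE [LHS]lmulA; congr lmul.
Qed.

Lemma lmul1r : right_id lone lmul.
Proof.
elim/pcls_ind; elim=> [[v|e|e]||x IHx y IHy|a x IHx|x IHx y IHy].
- by apply: (@lone_absr v); rewrite vert_mul eqxx.
- by apply: (@lone_absr (tgt e)); rewrite [LHS]pmulE; apply/relE/lpa_tgt.
- by apply: (@lone_absr (src e)); rewrite [LHS]pmulE; apply/relE/lpa_tgt_star.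
- exact: mul0x.
- by rewrite -pcls_add [LHS]pmulDl; congr (_ + _).
- by rewrite -pcls_scale -[LHS]pscaleAl; congr (_ *: _).
- by rewrite -pmulE -[LHS]lmulA; congr lmul.
Qed.

HB.instance Definition _ := Lmodule_isUAlgebra.Build F leavitt
  (@pmulA _ _ leavitt_rel) lmul1l lmul1r
  (@pmulDl _ _ leavitt_rel) (@pmulDr _ _ leavitt_rel)
  (@pscaleAl _ _ leavitt_rel) (@pscaleAr _ _ leavitt_rel).

End Leavitt.

(* Main.v *)
(* Modulo (CK2), the algebra is spanned by the elements p q* for walks p and q
   with a common end t that do not both end with the only arrow leaving some
   vertex.  Since the cycles are disjoint, a walk is determined by its origin, by
   the set of its arrows and by the number of its arrows on each cycle.  For a
   pair (p, q) as above the cycles met by p and those met by q are at most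
   ht(G) in number, counted together: along p the height drops by at least 2 at
   every cycle with an exit, and a cycle without exit is met last, by only one of
   p and q.  Hence O(n ^ ht(G)) elements p q* of length at most n are enough.

   Conversely, follow a descending chain of cycles that realizes the height of a
   cycle, going round each of them up to m times, until the final sink or cycle
   without exit.  The elements p z^l q* made of these walks, where z is the final
   cycle, are linearly independent, because the algebra acts on functions of
   boundary paths (infinite paths and paths ending at a sink) with an integer
   degree; there are (m + 1) ^ ht(G) of them, of length O(m). *)

Require Import Defs.
From HB Require Import structures.
From mathcomp Require Import all_boot all_order all_algebra.
From mathcomp Require Import all_classical all_reals all_analysis.
From mathcomp Require Import zify.

Set Implicit Arguments.
Unset Strict Implicit.
Unset Printing Implicit Defensive.

Import Order.TTheory GRing.Theory Num.Theory.
Import numFieldNormedType.Exports.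
Local Open Scope ring_scope.

(** * Spans and growth of powers *)

Section LinearSpan.
Local Open Scope classical_set_scope.
Variables (F : fieldType) (A : ualgType F).
Implicit Types (S W U : set A) (x y : A).

Lemma sub_lspan S : S `<=` lspan S.
Proof.
move=> x Sx; exists 1%N, (fun=> 1), (fun=> x); split=> //.
by rewrite big_ord1 scale1r.
Qed.

Lemma lspan0 S : lspan S 0.
Proof. by exists 0%N, (fun=> 0), (fun=> 0); split=> [[]//|]; rewrite big_ord0. Qed.

Lemma lspanZ S a x : lspan S x -> lspan S (a *: x).
Proof.
case=> n [c [u [Su ->]]]; exists n, (fun i => a * c i), u; split=> //.
by rewrite scaler_sumr; apply: eq_bigr => i _; rewrite scalerA.
Qed.

Lemma lspanD S x y : lspan S x -> lspan S y -> lspan S (x + y).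
Proof.
case=> n [c [u [Su ->]]] [m [d [v [Sv ->]]]].
exists (n + m)%N,
  (fun i : 'I_(n + m) => match fintype.split i with inl j => c j | inr j => d j end),
  (fun i : 'I_(_ + _) => match fintype.split i with inl j => u j | inr j => v j end).
split=> [i|]; first by case: (fintype.split i).
rewrite big_split_ord; congr (_ + _); apply: eq_bigr => i _.
- by rewrite (unsplitK (inl i)).
- by rewrite (unsplitK (inr i)).
Qed.

Lemma lspan_sum S (I : Type) (r : seq I) (P : pred I) (f : I -> A) :
  (forall i, P i -> lspan S (f i)) -> lspan S (\sum_(i <- r | P i) f i).
Proof.
move=> Sf; elim/big_ind: _ => //; [exact: lspan0|exact: lspanD].
Qed.

Lemma lspan_ind S (P : A -> Prop) : P 0 ->
  (forall a x y, P x -> P y -> P (a *: x + y)) ->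
  S `<=` P -> lspan S `<=` P.
Proof.
move=> P0 PD SP x [n [c [u [Su ->]]]]; elim/big_rec: _ => // i y _ Py.
by apply: PD => //; apply: SP.
Qed.

Lemma lspan_subP S U : S `<=` lspan U -> lspan S `<=` lspan U.
Proof.
apply: lspan_ind; first exact: lspan0.
by move=> a x y Ux Uy; apply: lspanD => //; apply: lspanZ.
Qed.

Lemma lspan_mono S U : S `<=` U -> lspan S `<=` lspan U.
Proof. by move=> SU; apply: lspan_subP => x /SU; apply: sub_lspan. Qed.

Lemma lspan_fin (I : finType) (u : I -> A) x :
  lspan (range u) x <-> exists c : I -> F, x = \sum_i c i *: u i.
Proof.
split=> [|[c ->]]; last first.
  by apply: lspan_sum => i _; apply/lspanZ/sub_lspan; exists i.
move: x; apply: lspan_ind.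
- by exists (fun=> 0); rewrite big1 // => i _; rewrite scale0r.
- move=> a _ _ [c ->] [d ->]; exists (fun i => a * c i + d i).
  rewrite scaler_sumr -big_split /=; apply: eq_bigr => i _.
  by rewrite scalerDl scalerA.
- move=> _ [i _ <-]; exists (fun j => (j == i)%:R).
  rewrite (bigD1 i) //= eqxx scale1r big1 ?addr0 // => j /negPf->.
  by rewrite scale0r.
Qed.

Lemma findim_fin (I : finType) (u : I -> A) : findim_subspace (lspan (range u)).
Proof.
exists #|I|, (u \o enum_val); apply/seteqP; split; apply: lspan_subP.
- by move=> _ [i _ <-]; apply: sub_lspan; exists (enum_rank i); rewrite //= enum_rankK.
- by move=> _ [i _ <-]; apply: sub_lspan; exists (enum_val i).
Qed.

(** If [n] exceeded [#|I|], the matrix of coefficients would have more rows than columns, and a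
    nonzero row vector in its left kernel would be a dependence among the [b i]. *)
Lemma lin_indep_le n (I : finType) (b : 'I_n -> A) (u : I -> A) :
  lin_indep b -> (forall i, lspan (range u) (b i)) -> (n <= #|I|)%N.
Proof.
move=> bind bu; rewrite leqNgt; apply/negP => In.
have /(_ _)/lspan_fin/cid-/all_sig[c cE] := bu.
pose M := \matrix_(i < n, j < #|I|) c i (enum_val j).
have /rowV0Pn[v /sub_kermxP vM /eqP[]] : kermx M != 0.
  rewrite -mxrank_eq0 mxrank_ker -lt0n subn_gt0.
  exact: leq_ltn_trans (rank_leq_col _) In.
apply/rowP => i; rewrite mxE; apply: (bind (v 0)) => {i}.
rewrite (eq_bigr (fun i => \sum_j (v 0 i * c i j) *: u j)); last first.
  move=> i _; rewrite cE scaler_sumr; apply: eq_bigr => j _.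
  by rewrite scalerA.
rewrite exchange_big big1 // => j _; rewrite -scaler_suml.
have := congr1 (fun B : 'rV_#|I| => B 0 (enum_rank j)) vM; rewrite !mxE => vM0.
suff -> : \sum_i v 0 i * c i j = 0 by rewrite scale0r.
rewrite -[RHS]vM0; apply: eq_bigr => i _.
by rewrite mxE enum_rankK.
Qed.

(** Induction on [n]: given a basis for all vectors but the first, the first is discarded if it lies
    in their span and adjoined otherwise. *)
Lemma basis_exists n (u : 'I_n -> A) : exists m (b : 'I_m -> A),
  lin_indep b /\ lspan (range b) = lspan (range u).
Proof.
elim: n u => [|n IHn] u.
  by exists 0%N, u; split=> // a _ [].
have [m [b [bi bE]]] := IHn (u \o lift ord0).
have [bu|bu] := pselect (lspan (range b) (u ord0)).
  exists m, b; split=> //; apply/seteqP; split.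
    by rewrite bE; apply: lspan_mono => _ [i _ <-]; exists (lift ord0 i).
  apply: lspan_subP => _ [i _ <-].
  case: (unliftP ord0 i) => [j|] -> //.
  by rewrite bE; apply: sub_lspan; exists j.
pose b' i := if unlift ord0 i is Some j then b j else u ord0.
have sumb' (a : 'I_m.+1 -> F) : \sum_(i < m.+1) a i *: b' i =
    a ord0 *: u ord0 + \sum_(i < m) a (lift ord0 i) *: b i.
  rewrite big_ord_recl {1}/b' unlift_none; congr (_ + _).
  by apply: eq_bigr => i _; rewrite /b' liftK.
exists m.+1, b'; split.
  move=> a; rewrite sumb' => a0.
  have a00 : a ord0 = 0.
    apply/eqP/negP => /negP a0n; apply: bu.
    move/eqP: a0; rewrite addr_eq0 => /eqP au.
    rewrite -[u _]scale1r -(mulVf a0n) -scalerA au.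
    apply/lspanZ; rewrite -scaleN1r; apply/lspanZ.
    by apply: lspan_sum => i _; apply/lspanZ/sub_lspan; exists i.
  move: a0; rewrite a00 scale0r add0r => /bi ab i.
  by case: (unliftP ord0 i) => [j|] ->.
apply/seteqP; split; apply: lspan_subP => _ [i _ <-].
  rewrite /b'; case: unliftP => [j _|_]; last by apply: sub_lspan; exists ord0.
  have : lspan (range b) (b j) by apply: sub_lspan; exists j.
  by rewrite bE; apply: lspan_mono => _ [k _ <-]; exists (lift ord0 k).
case: (unliftP ord0 i) => [j|] ->; last first.
  by apply: sub_lspan; exists ord0 => //; rewrite /b' unlift_none.
have : lspan (range b) (u (lift ord0 j)) by rewrite bE; apply: sub_lspan; exists j.
apply: lspan_mono => _ [k _ <-]; exists (lift ord0 k) => //.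
by rewrite /b' liftK.
Qed.

(** On a finite dimensional subspace the default value of [ldim] is never taken. *)
Lemma ldim_basis U : findim_subspace U ->
  exists b : 'I_(ldim U) -> A, lin_indep b /\ lspan (range b) = U.
Proof.
case=> n [u UE]; apply: (@xgetPex _ 0%N
  [set n | exists b : 'I_n -> A, lin_indep b /\ lspan (range b) = U]).
have [m [b [bi bE]]] := basis_exists u.
by exists m, b; rewrite bE UE.
Qed.

Lemma ldim_le (I : finType) (u : I -> A) U : findim_subspace U ->
  U `<=` lspan (range u) -> (ldim U <= #|I|)%N.
Proof.
move=> /ldim_basis[b [bi bE]] Uu; apply: (lin_indep_le bi) => i.
by apply: Uu; rewrite -bE; apply: sub_lspan; exists i.
Qed.

Lemma ldim_mono U W : findim_subspace U -> findim_subspace W -> U `<=` W ->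
  (ldim U <= ldim W)%N.
Proof.
move=> fU /ldim_basis[b [_ bE]] UW.
by rewrite -[ldim W]card_ord; apply: (@ldim_le _ b) => //; rewrite bE.
Qed.

Lemma ldim_ge n (b : 'I_n -> A) U : findim_subspace U -> lin_indep b ->
  (forall i, U (b i)) -> (n <= ldim U)%N.
Proof.
move=> /ldim_basis[c [_ cE]] bi bU.
by rewrite -[ldim U]card_ord; apply: (lin_indep_le (u := c) bi); rewrite cE.
Qed.

Lemma ldim_ge_fin (I : finType) (b : I -> A) U : findim_subspace U ->
  (forall a : I -> F, \sum_i a i *: b i = 0 -> forall i, a i = 0) ->
  (forall i, U (b i)) -> (#|I| <= ldim U)%N.
Proof.
move=> fU bi bU.
apply: (@ldim_ge _ (b \o enum_val) U fU) => [a a0 i|i]; last exact: bU.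
rewrite -[i]enum_valK; apply: (bi (a \o enum_rank)).
rewrite -[RHS]a0 (reindex_onto enum_val enum_rank) /=; last first.
  by move=> j _; rewrite enum_rankK.
apply: eq_big => [j|j _]; last by rewrite enum_valK.
by rewrite /= enum_valK eqxx.
Qed.

End LinearSpan.

(** * Powers of a generating subspace *)

Section PowerSpan.
Local Open Scope classical_set_scope.
Variables (F : fieldType) (A : ualgType F).
Implicit Types (S W U V : set A) (x y : A) (n : nat).

Lemma umul0l x : umul 0 x = 0 :> A.
Proof. by apply: (addIr (umul 0 x)); rewrite -umulDl !add0r. Qed.

Lemma umul0r x : umul x 0 = 0 :> A.
Proof. by apply: (addIr (umul x 0)); rewrite -umulDr !add0r. Qed.

HB.instance Definition _ := Monoid.isLaw.Build A uone umul (@umulA F A)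
  (@umul1l F A) (@umul1r F A).

Lemma lspan_mul S U T x y : (forall a b, S a -> U b -> lspan T (umul a b)) ->
  lspan S x -> lspan U y -> lspan T (umul x y).
Proof.
move=> ST Sx; move: y; apply: lspan_ind.
- by rewrite umul0r; apply: lspan0.
- by move=> a y z ? ?; rewrite umulDr -uscaleAr; apply: lspanD => //; apply: lspanZ.
move=> y Uy; move: x Sx; apply: lspan_ind.
- by rewrite umul0l; apply: lspan0.
- by move=> a x z ? ?; rewrite umulDl -uscaleAl; apply: lspanD => //; apply: lspanZ.
- by move=> x Sx; apply: ST.
Qed.

Lemma powspan_mul W m n x y :
  powspan W m x -> powspan W n y -> powspan W (m + n) (umul x y).
Proof.
apply: lspan_mul => _ _ [u [Wu ->]] [v [Wv ->]]; apply: sub_lspan.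
exists (fun i : 'I_(_ + _) => match fintype.split i with inl j => u j | inr j => v j end).
split=> [i|]; first by case: (fintype.split i).
rewrite big_split_ord; congr umul; apply: eq_bigr => i _.
- by rewrite (unsplitK (inl i)).
- by rewrite (unsplitK (inr i)).
Qed.

Lemma powspan0 W : powspan W 0 uone.
Proof.
by apply: sub_lspan; exists (fun=> uone); split=> [[]//|]; rewrite big_ord0.
Qed.

Lemma powspan1 W : W `<=` powspan W 1.
Proof.
move=> x Wx; apply: sub_lspan; exists (fun=> x); split=> //.
by rewrite big_ord1.
Qed.

Lemma powspan_le W m n : W uone -> (m <= n)%N -> powspan W m `<=` powspan W n.
Proof.
move=> W1 /subnK<-; elim: (n - m)%N => // k IHk x /IHk xk.
by rewrite addSn -addn1 -[x]umul1r; apply: powspan_mul => //; apply: powspan1.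
Qed.

(** Products are built from the right, one left factor at a time; this matches the later computation
    of left multiplication by a generator. *)
Lemma powspan_ind W (Q : nat -> A -> Prop) :
  (forall n, Q n 0) -> (forall n a x y, Q n x -> Q n y -> Q n (a *: x + y)) ->
  Q 0%N uone -> (forall n w x, W w -> Q n x -> Q n.+1 (umul w x)) ->
  forall n, powspan W n `<=` Q n.
Proof.
move=> Q0 QD Q1 QM n; apply: lspan_ind; [exact: Q0|exact: QD|].
move=> _ [w [Ww ->]]; elim: n w Ww => [|n IHn] w Ww.
  by rewrite big_ord0.
by rewrite big_ord_recl; apply: QM => //; apply: IHn.
Qed.

Lemma powspan_comp V W a n : W `<=` powspan V a ->
  powspan W n `<=` powspan V (n * a).
Proof.
move=> WV; apply: (@powspan_ind W (fun n => powspan V (n * a))) => {n}.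
- by move=> n; apply: lspan0.
- by move=> n c x y ? ?; apply: lspanD => //; apply: lspanZ.
- exact: powspan0.
- by move=> n w x /WV Vw Vx; rewrite mulSn; apply: powspan_mul.
Qed.

Lemma findim_powspan W n : findim_subspace W -> findim_subspace (powspan W n).
Proof.
case=> m [u WE]; elim: n => [|n [k [b bE]]].
  suff -> : powspan W 0 = lspan (range (fun _ : unit => uone)) by apply: findim_fin.
  apply/seteqP; split.
    by apply: lspan_mono => _ [w [_ ->]]; exists tt; rewrite // big_ord0.
  by apply: lspan_subP => _ [_ _ <-]; apply: powspan0.
suff -> : powspan W n.+1 = lspan (range (fun i : 'I_m * 'I_k => umul (u i.1) (b i.2))).
  exact: findim_fin.
apply/seteqP; split; apply: lspan_subP; last first.
  move=> _ [[i j] _ <-]; rewrite -add1n; apply: powspan_mul.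
    by apply: powspan1; rewrite WE; apply: sub_lspan; exists i.
  by rewrite bE; apply: sub_lspan; exists j.
move=> _ [w [Ww ->]]; rewrite big_ord_recl.
apply: (@lspan_mul (range u) (range b)).
- by move=> _ _ [i _ <-] [j _ <-]; apply: sub_lspan; exists (i, j).
- by rewrite -WE.
- by rewrite -bE; apply: sub_lspan; exists (fun i => w (lift ord0 i)).
Qed.

(** The elements that lie in some power of [V] form a subalgebra containing [V]. *)
Lemma frame_exhausts V : gk_frame V -> forall x, exists n, powspan V n x.
Proof.
case=> _ V1 Vg x; apply/asboolP.
apply: (Vg (fun x => `[< exists n, powspan V n x >])); last first.
  by move=> y Vy; apply/asboolP; exists 1%N; apply: powspan1.
split.
- by apply/asboolP; exists 0%N; apply: powspan0.
- move=> a y z /asboolP[n yn] /asboolP[m zm]; apply/asboolP; exists (maxn n m).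
  apply: lspanD; first by apply/lspanZ/(powspan_le V1 _ yn)/leq_maxl.
  exact/(powspan_le V1 _ zm)/leq_maxr.
- move=> y z /asboolP[n yn] /asboolP[m zm]; apply/asboolP; exists (n + m)%N.
  exact: powspan_mul.
Qed.

(** Applied in both directions to two frames, this makes their growths comparable up to a linear
    change of the exponent. *)
Lemma frame_sub_pow V W : gk_frame V -> findim_subspace W ->
  exists a, W `<=` powspan V a.
Proof.
move=> Vf [n [u ->]]; have [_ V1 _] := Vf.
have /(_ _)/cid-/all_sig[a aE] i := frame_exhausts Vf (u i).
exists (\max_i a i)%N; apply: lspan_subP => _ [i _ <-].
exact: powspan_le (leq_bigmax i) _ (aE i).
Qed.

End PowerSpan.

Lemma leq_exp2rW (m n e : nat) : (m <= n -> m ^ e <= n ^ e)%N.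
Proof. by case: e => // e mn; rewrite leq_exp2r. Qed.

(** * Polynomial growth determines the dimension *)

Section Growth.
Local Open Scope classical_set_scope.
Variable R : realType.

(** Taking logarithms, both bounds together say that the quotient differs from [d] by at most
    [ln C / ln n], which tends to 0. *)
Lemma ln_growth (u : nat -> nat) (d C N : nat) :
  (forall n, (N <= n)%N -> (n ^ d <= C * u n)%N) ->
  (forall n, (N <= n)%N -> (u n <= C * n ^ d)%N) ->
  (fun n => ln (u n)%:R / ln n%:R : R) @ \oo --> (d%:R : R).
Proof.
move=> lo up; apply/cvgrPdist_le => e e0.
near=> n.
have Nn : (N <= n)%N by near: n; apply: nbhs_infty_ge.
have n2 : (2 <= n)%N by near: n; apply: nbhs_infty_ge.
have n0 : (0 < n)%N by apply: leq_trans n2.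
have {lo}lo := lo n Nn; have {up}up := up n Nn.
have : (0 < C * u n)%N by apply: leq_trans lo; rewrite expn_gt0 n0.
rewrite muln_gt0 => /andP[C0 u0].
have nR : 0 < n%:R :> R by rewrite ltr0n.
have CR : 0 < C%:R :> R by rewrite ltr0n.
have uR : 0 < (u n)%:R :> R by rewrite ltr0n.
have ln0 : 0 < ln n%:R :> R by rewrite ln_gt0 // ltr1n.
have {}lo : d%:R * ln n%:R <= ln C%:R + ln (u n)%:R :> R.
  rewrite -lnM ?posrE // mulr_natl -lnXn // -natrX -natrM ler_ln ?posrE ?ltr0n ?ler_nat //.
    by rewrite expn_gt0 n0.
  by rewrite muln_gt0 C0.
have {}up : ln (u n)%:R <= ln C%:R + d%:R * ln n%:R :> R.
  rewrite mulr_natl -lnXn // -lnM ?posrE ?exprn_gt0 // -natrX -natrM.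
  by rewrite ler_ln ?posrE ?ltr0n ?ler_nat // muln_gt0 C0 expn_gt0 n0.
(* This holds as soon as [n] is at least [expR (ln C / e)]. *)
have Ce : ln C%:R <= e * ln n%:R :> R.
  rewrite mulrC -ler_pdivrMr // -[leLHS]expRK ler_ln ?posrE ?expR_gt0 //.
  by near: n; apply: nbhs_infty_ger.
have -> : d%:R - ln (u n)%:R / ln n%:R = (d%:R * ln n%:R - ln (u n)%:R) / ln n%:R :> R.
  by rewrite mulrBl mulfK // gt_eqF.
rewrite normrM normfV (gtr0_norm ln0) ler_pdivrMr //.
apply: le_trans Ce; rewrite ler_norml lerBrDr lerBlDr lo andbT.
by rewrite addrC lerBlDr addrC.
Unshelve. all: by end_near.
Qed.

Variables (F : fieldType) (A : ualgType F).

Lemma ldim0 n (W : set A) : findim_subspace W -> (uone : A) = 0 -> ldim (powspan W n) = 0%N.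
Proof.
move=> fW A0; apply/eqP; rewrite -leqn0.
rewrite -[leqRHS]card_void; apply: (@ldim_le _ _ _ (fun v : void => match v with end)).
  exact: findim_powspan.
by move=> x _; rewrite -[x]umul1l A0 umul0l; apply: lspan0.
Qed.

Lemma ldim_powspan_gt0 n (W : set A) : findim_subspace W -> W uone ->
  (uone : A) <> 0 -> (0 < ldim (powspan W n))%N.
Proof.
move=> fW W1 A0; apply: (@ldim_ge _ _ _ (fun=> uone)); first exact: findim_powspan.
  move=> a; rewrite big_ord1 => /eqP; rewrite scaler_eq0 => /orP[/eqP a0 i|/eqP//].
  by rewrite ord1.
by move=> _; apply: powspan_le (leq0n n) _ (powspan0 W).
Qed.

(** Bounds for one frame settle all frames. The lower bound is asked only for positive [d]: for
    [d = 0] it would fail in the zero algebra. *)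
Lemma has_GKdim_growth (V : set A) d c : gk_frame V ->
  ((0 < d)%N -> forall m, (m.+1 ^ d <= ldim (powspan V (c * m.+1)))%N) ->
  (forall n, (ldim (powspan V n) <= c * n.+1 ^ d)%N) ->
  has_GKdim A (d%:R%:E : \bar R).
Proof.
move=> Vf lo up; split=> [|W Wf]; first by exists V.
have [Vd V1 _] := Vf; have [Wd W1 _] := Wf.
apply: (cvg_limn_einf_sup _).2.
apply: cvg_EFin; first by near=> n.
rewrite /comp /=.
(* In the zero algebra a positive [d] would contradict [lo] at [m = 0], so [d = 0] and the sequence
   is constantly 0. *)
have [A0|A0] := pselect ((uone : A) = 0).
  have -> : d = 0%N.
    case: d lo {up} => // d lo; have := lo isT 0%N.
    by rewrite ldim0 // exp1n.
  under eq_fun do rewrite ldim0 // ln0 // mul0r.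
  exact: cvg_cst.
have [a Va] := frame_sub_pow Wf Vd.
have [b Wb] := frame_sub_pow Vf Wd.
have {}lo m : (m.+1 ^ d <= ldim (powspan V (c * m.+1)))%N.
  case: d lo {up} => [|d] lo; last exact: lo.
  by rewrite expn0 ldim_powspan_gt0.
have up' n : (0 < n)%N -> (ldim (powspan W n) <= c * b.+1 ^ d * n ^ d)%N.
  move=> n0; apply: leq_trans (ldim_mono _ _ (powspan_comp Wb)) _; try exact: findim_powspan.
  apply: leq_trans (up _) _; rewrite -mulnA -expnMn leq_mul // leq_exp2rW //.
  by rewrite mulSn mulnC addnC -addn1 leq_add2l.
(* With [q = n %/ K], the power of [V] with exponent [c * q] lies in that of [W] with exponent
   [c * q * a <= n], while [n <= 2 * K * q] once [K <= n]. *)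
pose K := (c * a).+1.
have lo' n : (K <= n)%N -> (n ^ d <= (2 * K) ^ d * ldim (powspan W n))%N.
  move=> Kn; have q0 : (0 < n %/ K)%N by rewrite divn_gt0.
  apply: leq_trans (_ : (2 * K * (n %/ K)) ^ d <= _)%N.
    apply: leq_exp2rW; apply: leq_trans (ltnW (ltn_ceil n (isT : 0 < K)%N)) _.
    by rewrite mulnC -mulnA mulnCA leq_mul2l mul2n -addnn -addn1 leq_add2l q0.
  rewrite expnMn leq_mul // -(prednK q0); apply: leq_trans (lo _) _.
  rewrite (prednK q0); apply: ldim_mono; try exact: findim_powspan.
  apply: subset_trans (powspan_comp Va) _; apply: powspan_le => //.
  apply: leq_trans (leq_divM n K); rewrite mulnAC [leqRHS]mulnC.
  by rewrite leq_mul2r leqnSn orbT.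
apply: (@ln_growth _ d (maxn (c * b.+1 ^ d) ((2 * K) ^ d)) K) => n Kn.
  by apply: leq_trans (lo' n Kn) _; rewrite leq_mul // leq_maxr.
apply: leq_trans (up' n _) _; first exact: leq_trans Kn.
by rewrite leq_mul // leq_maxl.
Unshelve. all: by end_near.
Qed.
End Growth.

(** * Walks and heights *)

Section Walks.
Variable G : digraph.
Implicit Types (u v w t : vertex G) (e f g : arrow G) (p q : seq (arrow G)).
Implicit Types (C D : {set arrow G}).

Fixpoint walk u p t : bool :=
  if p is e :: p' then (src e == u) && walk (tgt e) p' t else u == t.

Lemma walk_cat u p v q t : walk u p v -> walk v q t -> walk u (p ++ q) t.
Proof.
elim: p u => [|e p IHp] u /=; first by move/eqP->.
by case/andP=> -> /IHp; apply.
Qed.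

Lemma walk_rcons u p e t : walk u (rcons p e) t = walk u p (src e) && (tgt e == t).
Proof.
elim: p u => [|f p IHp] u /=; first by rewrite eq_sym.
by rewrite IHp andbA.
Qed.

Lemma reachP u t : reflect (exists p, walk u p t) (reach u t).
Proof.
apply: (iffP connectP) => [[p + ->]|[p]].
  elim: p u => [|v p IHp] u /=; first by exists [::]; apply: eqxx.
  case/andP=> /existsP[e /andP[eu /eqP ev]] /IHp[q qw].
  by exists (e :: q); rewrite /= eu ev.
elim: p u => [|e p IHp] u /=; first by move/eqP->; exists [::].
case/andP=> /eqP eu /IHp[q qp qt]; exists (tgt e :: q) => //=.
by rewrite qp andbT; apply/existsP; exists e; rewrite eu !eqxx.
Qed.

Lemma reach_arrow e : reach (src e) (tgt e).
Proof. by apply/reachP; exists [:: e]; rewrite /= !eqxx. Qed.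

Lemma walk_mem u p t e : walk u p t -> e \in p ->
  reach u (src e) /\ reach (tgt e) t.
Proof.
elim: p u => [|f p IHp] u //= /andP[/eqP<- fp].
rewrite inE => /predU1P[->|ep].
  by split; [apply: connect0|apply/reachP; exists p].
have [fe et] := IHp _ fp ep; split=> //.
exact: connect_trans (reach_arrow f) fe.
Qed.

Definition cyclic e := reach (tgt e) (src e).

Lemma mem_cycle_vertices C e : e \in C -> src e \in cycle_vertices C.
Proof. exact: imset_f. Qed.

(** A return path from [tgt e] to [src e], once shortened, repeats no vertex, so closing it up with
    [e] gives a cycle. *)
Lemma cyclicP e : reflect (exists2 C, C \in cycles G & e \in C) (cyclic e).
Proof.
apply: (iffP idP) => [/connectP[p + ep]|[C CC eC]]; last first.
  by apply: (cycle_connected CC); [apply: Defs.cycle_next|apply: mem_cycle_vertices].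
move=> pp; move: pp ep; case/shortenP=> q' tq' uq' _ {p} ep.
have [c [cs ct cp]] := lift_path tq'.
exists [set f in e :: c]%SET; last by rewrite inE mem_head.
apply/cyclesP; exists (e :: c) => //; apply/and3P; split=> //=.
- by rewrite rcons_path cp //= -(last_map (@tgt G)) ct ep eqxx.
- by rewrite cs ep; move: uq'; rewrite lastI rcons_uniq.
Qed.

Lemma cycle_src_inj C : C \in cycles G -> {in C &, injective (@src G)}.
Proof.
case/cyclesP=> c /and3P[_ _ uc] -> e f; rewrite !inE; exact: (uniq_src_inj uc).
Qed.

(** Around a cycle the targets are the sources rotated by one place, hence distinct as well. *)
Lemma cycle_tgt_inj C : C \in cycles G -> {in C &, injective (@tgt G)}.
Proof.
case/cyclesP=> [[|x c] // /and3P[_ xc uc]] ->.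
suff E : map (@tgt G) (x :: c) = rot 1 (map (@src G) (x :: c)).
  move=> e f; rewrite !inE -!in_cons.
  apply: (@uniq_src_inj (Digraph (@tgt G) (@src G)) (x :: c)).
  by rewrite E rot_uniq.
have -> : rot 1 (map (@src G) (x :: c)) = map (@src G) (rcons c x).
  by rewrite -map_rot /= rot1_cons.
rewrite -(belast_rcons x c x); move: xc; rewrite [cycle _ _]/=.
move: (rcons c x) => s; elim: s x {uc} => [|y s IHs] x //= /andP[/eqP-> ys].
by rewrite IHs.
Qed.

Lemma noexit_mem C e : C \in cycles G -> ~~ has_exit C ->
  src e \in cycle_vertices C -> e \in C.
Proof.
move=> CC nC /imsetP[f fC ef]; have [->//|nef] := eqVneq e f.
by case/negP: nC; apply/existsP; exists e; apply/existsP; exists f; rewrite fC ef eqxx.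
Qed.

Hypothesis dj : disjoint_cycles G.

Lemma cycles_eq C D v : C \in cycles G -> D \in cycles G ->
  v \in cycle_vertices C -> v \in cycle_vertices D -> C = D.
Proof.
move=> CC DD vC vD; apply/eqP/negPn/negP => CD.
by have /pred0P/(_ v) := dj CC DD CD; rewrite /= vC vD.
Qed.

(** Cycles through the two arrows share a vertex, so they coincide by disjointness, and a cycle has
    only one arrow at each of its vertices. *)
Lemma cyclic_inj e f : cyclic e -> cyclic f -> src e = src f -> e = f.
Proof.
move=> /cyclicP[C CC eC] /cyclicP[D DD fD] ef.
have CD : C = D.
  by apply: (cycles_eq CC DD (mem_cycle_vertices eC)); rewrite ef mem_cycle_vertices.
by apply: (cycle_src_inj CC); rewrite // CD.
Qed.

Section WalkCode.

(** Membership is enough for an arrow that is not cyclic, since a walk uses it at most once; the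
    arrows of a cycle are only counted together. *)
Definition same_code p q :=
  (forall e, ~~ cyclic e -> (e \in p) = (e \in q)) /\
  (forall C, C \in cycles G -> count (mem C) p = count (mem C) q).

Lemma same_code_sym p q : same_code p q -> same_code q p.
Proof. by case=> H1 H2; split=> *; rewrite ?H1 ?H2. Qed.

Lemma same_code_nil q : same_code [::] q -> q = [::].
Proof.
case: q => // f q [H1 H2]; have [/cyclicP[C CC fC]|nf] := boolP (cyclic f).
  by have := H2 C CC; rewrite /= fC.
by have := H1 f nf; rewrite mem_head.
Qed.

(** The second walk must later use [e], or an arrow on the cycle of [e]; either way it can return to
    the common source, so [f] lies on a cycle. *)
Let code_cyclic e f p q t : same_code (e :: p) (f :: q) -> e != f ->
  src e = src f -> walk (tgt f) q t -> cyclic f.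
Proof.
move=> [H1 H2] ef se qt; have [/cyclicP[C CC eC]|ne] := boolP (cyclic e).
  have : has (mem C) (f :: q) by rewrite has_count -H2 //= eC.
  case/orP=> [fC|/hasP[g gq gC]]; first by apply/cyclicP; exists C.
  have [fg _] := walk_mem qt gq; apply: connect_trans fg _.
  by rewrite -se; apply: (cycle_connected CC); rewrite mem_cycle_vertices.
have := H1 e ne; rewrite mem_head inE (negPf ef) => /esym eq.
by have [] := walk_mem qt eq; rewrite se.
Qed.

(* Where two walks from the same vertex part, only one of the two arrows can lie
   on a cycle, and the walk that takes the other arrow never comes back. *)
Lemma walk_code_inj u p q t t' : walk u p t -> walk u q t' ->
  same_code p q -> p = q.
Proof.
elim: p u q => [|e p IHp] u [|f q] //=.
- by move=> _ _ /same_code_nil.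
- by move=> _ _ /same_code_sym/same_code_nil.
case/andP=> /eqP eu pt /andP[/eqP fu qt] pq.
have ef : e = f.
  apply/eqP/negPn/negP => nef; case/eqP: (nef).
  apply: cyclic_inj; rewrite ?eu ?fu //.
    by apply: (code_cyclic (same_code_sym pq) _ _ pt); rewrite 1?eq_sym ?eu ?fu.
  by apply: (code_cyclic pq _ _ qt); rewrite ?eu ?fu.
rewrite {}ef in eu pt pq *; congr (_ :: _); apply: (IHp _ _ pt qt).
(* The codes still agree after the common first arrow is dropped: if it is not cyclic, it recurs in
   neither tail. *)
case: pq => H1 H2; split=> [g ng|C CC].
  have := H1 g ng; rewrite !inE; case: eqVneq => [gf _|//].
  rewrite {}gf in ng *; apply/idP/idP => fI.
    by case/negP: ng; have [] := walk_mem pt fI.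
  by case/negP: ng; have [] := walk_mem qt fI.
by have := H2 C CC => /= /addnI.
Qed.

End WalkCode.

(** * Cycles met by a walk, counted against the height *)

Definition cycles_met p : {set {set arrow G}} :=
  [set C in cycles G | has (mem C) p]%SET.
Definition exit_cycles_met p : {set {set arrow G}} :=
  [set C in cycles G | has_exit C && has (mem C) p]%SET.

Lemma in_cycles_met C p : (C \in cycles_met p) = (C \in cycles G) && has (mem C) p.
Proof. by rewrite finset.in_set. Qed.

Lemma in_exit_cycles_met C p : (C \in exit_cycles_met p) =
  [&& C \in cycles G, has_exit C & has (mem C) p].
Proof. by rewrite finset.in_set. Qed.

Definition on_closed t : bool :=
  [exists C in cycles G, ~~ has_exit C && (t \in cycle_vertices C)].

Lemma height_step C y : C \in cycles G -> has_exit C -> y \in nodes G ->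
  leads (inr C) y -> y != inr C -> (2 + height y <= height (inr C : node G))%N.
Proof.
move=> CC eC yn Cy yC; rewrite (height_cycle dj CC) eC leq_add2l.
by apply: leq_bigmax_cond; rewrite yn Cy.
Qed.

Lemma height_noexit C : C \in cycles G -> ~~ has_exit C ->
  height (inr C : node G) = 1%N.
Proof. by move=> CC nC; rewrite (height_cycle dj CC) (negPf nC). Qed.

Lemma leads_walk C D u v : u \in cycle_vertices C -> v \in cycle_vertices D ->
  reach u v -> leads (inr C : node G) (inr D).
Proof. by move=> uC vD uv; apply/leadsP; exists u, v. Qed.

Lemma inr_eq C D : ((inr C : node G) == inr D) = (C == D).
Proof. by []. Qed.

(** Induction from the end of the walk. The bound is attached to a cycle reachable from the start,
    so that a newly met cycle leads to it and has height larger by at least 2. *)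
Lemma exit_cycles_met_height u p t : walk u p t -> exit_cycles_met p = finset.set0 \/
  exists C v, [/\ C \in exit_cycles_met p, v \in cycle_vertices C, reach u v &
    (2 * #|exit_cycles_met p| + on_closed t <= height (inr C : node G))%N].
Proof.
elim: p u => [|e p IHp] u.
  by move=> _; left; apply/setP=> C; rewrite in_exit_cycles_met finset.in_set0 /= !andbF.
case/andP=> /eqP <-{u} ept; have {IHp} := IHp _ ept.
have et : reach (src e) t by apply/reachP; exists (e :: p); rewrite /= eqxx.
have [/existsP[C /and3P[CC xC eC]]|ne] :=
    boolP [exists C in cycles G, has_exit C && (e \in C)]; last first.
  have -> : exit_cycles_met (e :: p) = exit_cycles_met p.
    apply/setP=> C; rewrite !in_exit_cycles_met /=; case CC: (C \in cycles G) => //=.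
    case xC: (has_exit C) => //=; case eC: (e \in C) => //=.
    by case/negP: ne; apply/existsP; exists C; rewrite CC xC eC.
  case=> [|[C [v [CS vC ev hC]]]]; [by left|right].
  by exists C, v; split=> //; apply: connect_trans (reach_arrow e) ev.
have SE : exit_cycles_met (e :: p) = C |: exit_cycles_met p.
  apply/setP=> D; rewrite finset.in_setU1 !in_exit_cycles_met /=.
  have [->|DC] := eqVneq D C; first by rewrite CC xC eC.
  case DD: (D \in cycles G) => //=; case xD: (has_exit D) => //=.
  case eD: (e \in D) => //=; case/eqP: DC.
  exact: cycles_eq DD CC (mem_cycle_vertices eD) (mem_cycle_vertices eC).
have [Cp|Cp] := boolP (C \in exit_cycles_met p).
  have -> : exit_cycles_met (e :: p) = exit_cycles_met p.
    by rewrite SE; apply/finset.setUidPr; rewrite finset.sub1set.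
  case=> [S0|[D [v [DS vD ev hD]]]]; right; first by rewrite S0 inE in Cp.
  by exists D, v; split=> //; apply: connect_trans (reach_arrow e) ev.
have CS : C \in exit_cycles_met (e :: p) by rewrite SE finset.setU11.
move=> IH; right; exists C, (src e); split=> //; [exact: mem_cycle_vertices|exact: connect0|].
rewrite SE cardsU1 Cp mulnDr muln1 -addnA.
case: IH => [S0|[D [v [DS vD ev hD]]]].
  rewrite S0 cards0 muln0 add0n.
  case: (boolP (on_closed t)) => [/existsP[D /and3P[DD xD tD]]|_]; last first.
    by rewrite (height_cycle dj CC) xC leq_addr.
  (* The summand 1 is read as the height of the final cycle without exit, so that [height_step]
     applies. *)
  rewrite -[true : nat](height_noexit DD xD).
  apply: height_step; rewrite // ?nodesE //.
    exact: leads_walk (mem_cycle_vertices eC) tD et.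
  by rewrite inr_eq; apply: contraNneq xD => ->.
have DD : D \in cycles G by move: DS; rewrite in_exit_cycles_met => /andP[->].
have CD : leads (inr C : node G) (inr D).
  apply: leads_walk (mem_cycle_vertices eC) vD _.
  exact: connect_trans (reach_arrow e) ev.
apply: leq_trans (height_step CC xC _ CD _); rewrite ?leq_add2l ?nodesE //.
by rewrite inr_eq; apply: contraNneq Cp => <-.
Qed.

Lemma exit_cycles_met_le u p t : walk u p t ->
  (2 * #|exit_cycles_met p| + on_closed t <= digraph_height G)%N.
Proof.
move=> pt; have hle C : C \in cycles G -> (height (inr C : node G) <= digraph_height G)%N.
  by move=> CC; apply: (leq_bigmax_cond (F := fun C => height (inr C : node G))).
case: (exit_cycles_met_height pt) => [->|[C [v [CS _ _ hC]]]]; last first.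
  by apply: leq_trans hC (hle _ _); move: CS; rewrite in_exit_cycles_met => /andP[].
rewrite cards0 muln0 add0n.
case: (boolP (on_closed t)) => // /existsP[D /and3P[DD xD tD]].
by rewrite -[true : nat](height_noexit DD xD) hle.
Qed.

(** Once a walk has used an arrow of a cycle without exit, all its later arrows belong to that
    cycle. *)
Lemma noexit_last D u p t : D \in cycles G -> ~~ has_exit D -> walk u p t ->
  has (mem D) p -> exists p' e, p = rcons p' e /\ e \in D.
Proof.
move=> DD xD; elim: p u => [|e p IHp] u //= /andP[_ ept].
have [pD _|pD] := boolP (has (mem D) p).
  by have [p' [f [-> fD]]] := IHp _ ept pD; exists (e :: p'), f.
rewrite orbF => eD; case: p ept pD {IHp} => [|f p /=]; first by exists [::], e.
case/andP=> /eqP fe _ /norP[/negP[]]; apply: (noexit_mem DD xD).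
by rewrite fe Defs.cycle_next.
Qed.

Definition meets_closed p : bool :=
  [exists C in cycles G, ~~ has_exit C && has (mem C) p].

(** Two cycles without exit met by the same walk would both contain its last arrow, so at most one
    has to be added. *)
Lemma cycles_met_le u p t : walk u p t ->
  (#|cycles_met p| <= #|exit_cycles_met p| + meets_closed p)%N.
Proof.
move=> pt; case: (boolP (meets_closed p)) => [/existsP[D /and3P[DD xD Dp]]|np].
  have -> : (#|exit_cycles_met p| + true = #|D |: exit_cycles_met p|)%N.
    by rewrite cardsU1 in_exit_cycles_met (negPf xD) andbF addnC.
  apply/subset_leq_card/fintype.subsetP => C.
  rewrite finset.in_setU1 in_cycles_met in_exit_cycles_met => /andP[CC Cp].
  rewrite CC Cp andbT /=; have [_|xC] := boolP (has_exit C); first by rewrite orbT.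
  rewrite orbF.
  have [p' [e [pE eD]]] := noexit_last DD xD pt Dp.
  have [p'' [f []]] := noexit_last CC xC pt Cp.
  rewrite pE => /rcons_inj[_ <-] eC; apply/eqP.
  exact: cycles_eq CC DD (mem_cycle_vertices eC) (mem_cycle_vertices eD).
rewrite addn0; apply/subset_leq_card/fintype.subsetP => C.
rewrite in_cycles_met in_exit_cycles_met => /andP[CC Cp]; rewrite CC Cp andbT andTb.
apply: contraT => xC; case/negP: np; apply/existsP; exists C.
by rewrite CC xC.
Qed.

(* Pairs of walks [p, q] for which [p q*] is not shortened by (CK2) at a vertex
   that emits a single arrow. *)
Definition reduced p q := forall p' q' e, p = rcons p' e -> q = rcons q' e ->
  exists2 f, src f = src e & f != e.

Lemma reduced_cycles_met u w p q t : walk u p t -> walk w q t -> reduced p q ->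
  (#|cycles_met p| + #|cycles_met q| <= digraph_height G)%N.
Proof.
move=> pt qt red.
have closed x r : walk x r t -> (meets_closed r <= on_closed t)%N.
  move=> rt; case: (boolP (meets_closed r)) => // /existsP[D /and3P[DD xD Dr]].
  rewrite lt0b; apply/existsP; exists D; rewrite DD xD /=.
  have [r' [e [rE eD]]] := noexit_last DD xD rt Dr.
  move: rt; rewrite rE walk_rcons => /andP[_ /eqP<-].
  exact: Defs.cycle_next.
(* Otherwise both walks end on the cycle through [t] with the same last arrow, which is the only
   arrow leaving its source; this contradicts [reduced]. *)
have excl : (meets_closed p + meets_closed q <= 1)%N.
  case: (boolP (meets_closed p)) => [/existsP[D /and3P[DD xD Dp]]|_]; last first.
    by case: (meets_closed q).
  case: (boolP (meets_closed q)) => // /existsP[C /and3P[CC xC Cq]].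
  have [p' [e [pE eD]]] := noexit_last DD xD pt Dp.
  have [q' [f [qE fC]]] := noexit_last CC xC qt Cq.
  move: pt qt; rewrite pE qE !walk_rcons => /andP[_ /eqP et] /andP[_ /eqP ft].
  have CD : C = D.
    by apply: (cycles_eq CC DD (v := t)); [rewrite -ft|rewrite -et]; apply: Defs.cycle_next.
  have ef : e = f by apply: (cycle_tgt_inj DD); rewrite // -?CD // et ft.
  have [g ge gne] := red p' q' e pE (etrans qE (congr1 _ (esym ef))).
  case/negP: gne; apply/eqP; apply: (cycle_src_inj DD _ eD ge).
  by apply: (noexit_mem DD xD); rewrite ge mem_cycle_vertices.
(* The two height bounds are averaged: their terms [on_closed t] add up to 2, enough to pay twice
   for the single cycle without exit. *)
have := exit_cycles_met_le pt; have := exit_cycles_met_le qt.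
have := cycles_met_le pt; have := cycles_met_le qt.
have := closed _ _ pt; have := closed _ _ qt.
lia.
Qed.

End Walks.

(** * Boundary paths *)

Section BoundaryPaths.
Variable G : digraph.
Implicit Types (u v w t : vertex G) (e f g : arrow G) (p q : seq (arrow G)).
Implicit Types (C D : {set arrow G}).

(* A path that reaches a sink [v] is continued by the letter [inr v] forever. *)
Definition letter : Type := (arrow G + vertex G)%type.
Definition lsrc (x : letter) := match x with inl e => src e | inr v => v end.
Definition ltgt (x : letter) := match x with inl e => tgt e | inr v => v end.
Implicit Types (xi eta omega : nat -> letter).

(** After a letter [inr v] the next letter has source [v], a sink, and is therefore [inr v]
    again. *)
Definition boundary u xi : Prop := lsrc (xi 0%N) = u /\
  forall n, lsrc (xi n.+1) = ltgt (xi n) /\ (forall v, xi n = inr v -> sink v).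

Definition scons e xi : nat -> letter := fun n => if n is m.+1 then xi m else inl e.
Definition prepend p xi := foldr scons xi p.

Lemma scons_inj e xi eta : scons e xi = scons e eta -> xi = eta.
Proof. by move=> E; apply/funext => n; have := congr1 (@^~ n.+1) E. Qed.

Lemma scons_head e f xi eta : scons e xi = scons f eta -> e = f.
Proof. by move/(congr1 (@^~ 0%N)) => -[]. Qed.

Lemma prepend_inj p : injective (prepend p).
Proof. by elim: p => [|e p IHp] xi eta //= /scons_inj/IHp. Qed.

Lemma prepend_cat p q xi : prepend (p ++ q) xi = prepend p (prepend q xi).
Proof. exact: foldr_cat. Qed.

Lemma boundary_scons u e xi :
  boundary u (scons e xi) <-> src e = u /\ boundary (tgt e) xi.
Proof.
split=> [[eu H]|[eu [xe H]]].
  split=> //; split; first by have [] := H 0%N.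
  by move=> n; apply: (H n.+1).
by split=> // -[|n] //=; apply: H.
Qed.

Lemma boundary_head u xi : boundary u xi -> ~~ sink u ->
  exists2 e, src e = u & exists2 eta, xi = scons e eta & boundary (tgt e) eta.
Proof.
move=> ux; have [xu H] := ux; move: (H 0%N) => [_ H0].
case x0: (xi 0%N) xu => [e|v] /= eu; last by rewrite -eu H0.
move=> _; exists e => //; exists (fun n => xi n.+1).
  by apply/funext => -[|n].
by split=> [|n]; [have [] := H 0%N; rewrite x0|apply: H].
Qed.

Lemma boundary_prepend u p t xi : walk u p t -> boundary t xi ->
  boundary u (prepend p xi).
Proof.
elim: p u => [|e p IHp] u /=; first by move/eqP->.
by case/andP=> /eqP eu pt tx; apply/boundary_scons; split=> //; apply: IHp.
Qed.

Lemma boundary_src u v xi : boundary u xi -> boundary v xi -> u = v.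
Proof. by case=> <- _ [<-]. Qed.

Definition terminal t omega := forall xi, boundary t xi <-> xi = omega.

Lemma sink_terminal t : sink t -> terminal t (fun=> inr t).
Proof.
move=> st xi; split=> [[xt H]|->]; last by split=> // n; split=> // v [<-].
suff xE n : lsrc (xi n) = t -> xi n = inr t.
  apply/funext; elim=> [|n IHn]; first exact: xE.
  by apply: xE; have [-> _] := H n; rewrite IHn.
by case: (xi n) => [e|v] /= => [et|->//]; move/forallP/(_ e): st; rewrite et eqxx.
Qed.

(** Every vertex of such a cycle emits exactly one arrow, so all letters of a boundary path are
    forced. *)
Lemma closed_terminal C t : C \in cycles G -> ~~ has_exit C ->
  t \in cycle_vertices C -> exists omega, terminal t omega.
Proof.
move=> CC xC /imsetP[e0 e0C tE].
have nextP e : exists f, e \in C -> f \in C /\ src f = tgt e.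
  have [eC|eC] := boolP (e \in C); last by exists e.
  by have /imsetP[f fC fE] := Defs.cycle_next CC eC; exists f.
have [next {}nextP] := boolp.choice nextP.
have iC n : iter n next e0 \in C.
  by elim: n => [|n /nextP[]].
pose omega n : letter := inl (iter n next e0).
exists omega => xi; split=> [[xt H]|->]; last first.
  by split=> // n; split=> //=; have [_ ->] := nextP _ (iC n).
have xE n : lsrc (xi n) = src (iter n next e0) -> xi n = omega n.
  have nC := mem_cycle_vertices (iC n).
  case xn: (xi n) => [e|v] /= eE.
    rewrite /omega; congr inl; apply: (cycle_src_inj CC) => //.
    by apply: (noexit_mem CC xC); rewrite eE.
  have [_ /(_ v xn)/forallP/(_ (iter n next e0))] := H n.
  by rewrite eE eqxx.
apply/funext; elim=> [|n IHn]; first by apply: xE; rewrite xt tE.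
apply: xE; have [-> _] := H n; rewrite IHn /=.
by have [_ ->] := nextP _ (iC n).
Qed.

Lemma cycle_loop C t : C \in cycles G -> t \in cycle_vertices C ->
  exists e p, e \in C /\ walk t (e :: p) t.
Proof.
move=> CC /imsetP[e eC ->].
have /reachP[p ep] : cyclic e by apply/cyclicP; exists C.
by exists e, p; rewrite /= eqxx.
Qed.

Hypothesis dj : disjoint_cycles G.

(** Induction on the number of reachable vertices, which drops along an arrow that is not cyclic:
    its source cannot be reached from its target. *)
Lemma reach_node v : exists x w, [/\ x \in nodes G, w \in node_vertices x & reach v w].
Proof.
have [n] := ubnP #|[set w | reach v w]%SET|; elim: n v => // n IHn v.
have [sv _|/forallPn[e /negPn/eqP ev] vn] := boolP (sink v).
  by exists (inl v), v; split; [rewrite nodesE|apply: finset.set11|apply: connect0].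
subst v; have [/cyclicP[C CC eC]|ne] := boolP (cyclic e).
  exists (inr C), (src e).
  by split; [rewrite nodesE|apply: mem_cycle_vertices|apply: connect0].
have [|x [w [xn wx ew]]] := IHn (tgt e).
  rewrite ltnS in vn; apply: leq_trans vn; apply/proper_card/properP; split.
    apply/fintype.subsetP => w; rewrite !finset.in_set.
    exact: connect_trans (reach_arrow e).
  by exists (src e); rewrite finset.in_set; [apply: connect0|apply: ne].
by exists x, w; split=> //; apply: connect_trans (reach_arrow e) ew.
Qed.

(** The arrow is the first one outside [C] on a walk from [C] to [y]. *)
Lemma leave_cycle C y : C \in cycles G -> y \in nodes G -> y != inr C ->
  leads (inr C) y -> exists e v, [/\ src e \in cycle_vertices C, e \notin C,
    v \in node_vertices y & reach (tgt e) v].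
Proof.
move=> CC yn yC /leadsP[u [v [/= uC vy /reachP[p pv]]]].
have vC : v \notin cycle_vertices C.
  case: y yn yC vy => [s|D]; rewrite nodesE /=.
    move=> /forallP ss _ /set1P->; apply/imsetP => -[e _ es].
    by have := ss e; rewrite es eqxx.
  by move=> DD DC vD; apply: contra DC => vC; rewrite inr_eq (cycles_eq dj DD CC vD vC).
elim: p u uC pv => [|e p IHp] u uC /=.
  by move/eqP=> uv; rewrite -uv uC in vC.
case/andP=> /eqP eu pv; have [eC|eC] := boolP (e \in C).
  exact: IHp (Defs.cycle_next CC eC) pv.
by exists e, v; rewrite eu; split=> //; apply/reachP; exists p.
Qed.

(** Any node reached through an exit will do: if it were [C] again, the exit would be a second
    cyclic arrow at its source. *)
Lemma exit_successor C : C \in cycles G -> has_exit C ->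
  exists y, [/\ y \in nodes G, y != inr C & leads (inr C) y].
Proof.
move=> CC /existsP[e /existsP[f /and3P[fC /eqP ef nef]]].
have [y [w [yn wy ew]]] := reach_node (tgt e).
exists y; split=> //; last first.
  apply/leadsP; exists (src e), w; split=> //; first by rewrite ef /= mem_cycle_vertices.
  exact: connect_trans (reach_arrow e) ew.
apply: contra nef => /eqP yE; rewrite {}yE /= in wy.
have cf : cyclic f by apply/cyclicP; exists C.
apply/eqP/(cyclic_inj dj) => //; apply: connect_trans ew _.
by rewrite ef; apply: (cycle_connected CC); rewrite ?mem_cycle_vertices.
Qed.

Lemma height_successor C : C \in cycles G -> has_exit C ->
  exists y, [/\ y \in nodes G, y != inr C, leads (inr C) y &
    height (inr C : node G) = (2 + height y)%N].
Proof.
move=> CC xC; have [y0 [y0n y0C Cy0]] := exit_successor CC xC.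
pose P := [pred y | (y \in nodes G) && (leads (inr C) y && (y != inr C))].
have [|y] := @eq_bigmax_cond _ P (@height G).
  by apply/card_gt0P; exists y0; rewrite inE /= y0n Cy0.
rewrite inE => /and3P[yn Cy yC] hy; exists y; split=> //.
by rewrite (height_cycle dj CC) xC -hy.
Qed.

Definition repeat (z : seq (arrow G)) n := iter n (cat z) [::].

Lemma walk_repeat t z n : walk t z t -> walk t (repeat z n) t.
Proof. by move=> tz; elim: n => [|n IHn]; rewrite /= ?eqxx //; apply: walk_cat IHn. Qed.

Lemma size_repeat z n : size (repeat z n) = (n * size z)%N.
Proof. by elim: n => //= n IHn; rewrite size_cat IHn mulSn. Qed.

(** The letter [f], being different from [e], marks where the rounds stop, so their number can be
    read off. *)
Lemma prepend_repeat_inj e p f a b xi eta : e != f ->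
  prepend (repeat (e :: p) a) (scons f xi) = prepend (repeat (e :: p) b) (scons f eta) ->
  a = b /\ xi = eta.
Proof.
move=> ef; elim: a b => [|a IHa] [|b] //=; rewrite ?prepend_cat.
- by move/scons_inj.
- by move/scons_head => fe; rewrite fe eqxx in ef.
- by move/scons_head => fe; rewrite fe eqxx in ef.
- by move/scons_inj/prepend_inj/IHa => [-> ->].
Qed.

(** Length of a walk in [walk_family]: [i] rounds of a loop of length [r.+1], connecting walks of
    lengths [a] and [g], one exit arrow, and [s] arrows from the next node on. *)
Let family_bound (a i r g s c m : nat) : (i < m.+1)%N -> (s <= c * m.+1)%N ->
  (a + (i * r.+1 + (g + s).+1) <= (a + r.+1 + g.+1 + c) * m.+1)%N.
Proof. nia. Qed.

(* [P] enumerates walks that go round each of [k] successive cycles at most [m]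
   times; [b] tells whether the terminal vertex [t] lies on a cycle, in which
   case [z] is a nontrivial closed walk at [t]. *)
Lemma walk_family x v : x \in nodes G -> v \in node_vertices x ->
  exists t omega z k c (b : bool),
  [/\ terminal t omega, walk t z t, b -> (0 < size z)%N,
      height x = (2 * k + b)%N &
      forall m, exists (I : finType) (P : I -> seq (arrow G)),
        [/\ #|I| = (m.+1 ^ k)%N, forall i, walk v (P i) t,
            forall i, (size (P i) <= c * m.+1)%N &
            injective (fun i => prepend (P i) omega)]].
Proof.
have [n] := ubnP (height x); elim: n x v => // n IHn x v hx xn vx.
case: x hx xn vx => [s|C]; rewrite nodesE /= => hx.
  move=> ss /set1P->; exists s, (fun=> inr s), [::], 0%N, 0%N, false; split=> //=.
  - exact: sink_terminal.
  - by rewrite /height; case: #|nodes G|.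
  - move=> m; exists unit, (fun=> [::]); split=> [|_|_|[] []] //.
      by rewrite card_unit expn0.
    exact: eqxx.
move=> CC vC; have [xC|xC] := boolP (has_exit C); last first.
  have [omega om] := closed_terminal CC xC vC.
  have [e [p [eC ep]]] := cycle_loop CC vC.
  exists v, omega, (e :: p), 0%N, 0%N, true; split=> //=.
    by rewrite height_noexit.
  move=> m; exists unit, (fun=> [::]); split=> [|_|_|[] []] //.
    by rewrite card_unit expn0.
  exact: eqxx.
have [y [yn yC Cy hC]] := height_successor CC xC.
have [e [w [eC neC wy /reachP[g gw]]]] := leave_cycle CC yn yC Cy.
have [f [r [fC fr]]] := cycle_loop CC eC.
have fe : f != e by apply: contraNneq neC => <-.
have /reachP[h hv] := cycle_connected CC vC eC.
have [|t [om [z [k [c [b [tom zt bz hy H]]]]]]] := IHn y w _ yn wy.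
  by rewrite hC ltnS in hx; apply: ltnW hx.
exists t, om, z, k.+1, (size h + (size r).+1 + (size g).+1 + c)%N, b; split=> //.
  by rewrite hC hy mulnS addnA.
move=> m; have [I [P [cI Pw Ps Pinj]]] := H m.
(* Each walk goes to the vertex where [C] is left, makes [i.1] rounds, takes the exit [e] and
   continues with a walk of the family of [y]. *)
exists ('I_m.+1 * I)%type,
  (fun i : 'I_m.+1 * I => h ++ repeat (f :: r) i.1 ++ e :: g ++ P i.2); split.
- by rewrite card_prod card_ord cI expnS.
- move=> i; apply: walk_cat hv _; apply: walk_cat (walk_repeat _ fr) _ => /=.
  by rewrite eqxx; apply: walk_cat gw _.
- move=> [i j] /=; rewrite !size_cat size_repeat /= size_cat.
  exact: family_bound (ltn_ord i) (Ps j).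
- move=> [i j] [i' j'] /=; rewrite !prepend_cat /= => /prepend_inj.
  case/(prepend_repeat_inj fe) => ii'.
  rewrite !prepend_cat => /prepend_inj/Pinj->.
  by congr (_, _); apply: val_inj.
Qed.

End BoundaryPaths.

(** * Monomials of a Leavitt path algebra *)

Section LeavittMonomials.
Variables (F : fieldType) (G : digraph).
Notation L := (leavitt F G).
Notation cls := (pcls (@leavitt_rel F G)).
Implicit Types (u v w t : vertex G) (e f g : arrow G) (p q : seq (arrow G)).
Implicit Types (x y : L).

Definition larr e : L := cls (TGen (Arr e)).
Definition lstar e : L := cls (TGen (Star e)).

Lemma cls_rel (a b : term F (generator G)) : leavitt_rel a b -> cls a = cls b.
Proof. by move=> ab; apply/pclsP/congr_rel. Qed.

Lemma lmulE (a b : term F (generator G)) : lmul (cls a) (cls b) = cls (TMul a b).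
Proof. exact: pmulE. Qed.

Lemma lmulA : associative (@lmul F G).
Proof. exact: pmulA. Qed.

Lemma lmul0l x : lmul 0 x = 0. Proof. exact: (@umul0l F L). Qed.
Lemma lmul0r x : lmul x 0 = 0. Proof. exact: (@umul0r F L). Qed.

Lemma vert_vert v w : lmul (lvert F v) (lvert F w) = if v == w then lvert F v else 0.
Proof. by rewrite lmulE (cls_rel (lpa_V _ _ _)); case: eqP. Qed.

Lemma src_larr e : lmul (lvert F (src e)) (larr e) = larr e.
Proof. by rewrite lmulE (cls_rel (lpa_src _ _)). Qed.

Lemma larr_tgt e : lmul (larr e) (lvert F (tgt e)) = larr e.
Proof. by rewrite lmulE (cls_rel (lpa_tgt _ _)). Qed.

Lemma tgt_lstar e : lmul (lvert F (tgt e)) (lstar e) = lstar e.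
Proof. by rewrite lmulE (cls_rel (lpa_src_star _ _)). Qed.

Lemma lstar_src e : lmul (lstar e) (lvert F (src e)) = lstar e.
Proof. by rewrite lmulE (cls_rel (lpa_tgt_star _ _)). Qed.

Lemma lstar_larr e f :
  lmul (lstar e) (larr f) = if e == f then lvert F (tgt e) else 0.
Proof. by rewrite lmulE (cls_rel (lpa_CK1 _ _ _)); case: eqP. Qed.

Lemma larr_lstar e : (forall f, src f = src e -> f = e) ->
  lmul (larr e) (lstar e) = lvert F (src e).
Proof.
move=> eu; rewrite lmulE [RHS](cls_rel (lpa_CK2 _ _)); last first.
  by apply/forallPn; exists e; rewrite eqxx.
have -> : [seq f <- enum (arrow G) | src f == src e] = [:: e].
  rewrite (@eq_filter _ _ (pred1 e)) ?filter_pred1_uniq ?enum_uniq ?mem_enum //.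
  by move=> f /=; apply/eqP/eqP => [/eu|->].
by rewrite /= -pcls_add [X in _ + X](_ : _ = 0) ?addr0.
Qed.

Definition lpath p x : L := foldr (fun e y => lmul (larr e) y) x p.
(** The star of the first arrow of [q] ends up rightmost, as it does in q*. *)
Definition rpath q x : L := foldr (fun e y => lmul y (lstar e)) x q.
(* The element [p t q*] for walks [p] and [q] that end at [t]. *)
Definition mono p t q : L := lpath p (rpath q (lvert F t)).

Lemma lmul_rpath x q y : lmul x (rpath q y) = rpath q (lmul x y).
Proof. by elim: q => //= e q IHq; rewrite lmulA IHq. Qed.

Lemma rpath0 q : rpath q 0 = 0.
Proof. by elim: q => //= e q ->; apply: lmul0l. Qed.

Lemma vert_mono u v p t q : walk u p t ->
  lmul (lvert F v) (mono p t q) = if v == u then mono p t q else 0.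
Proof.
case: p => [/eqP->|e p] /=.
  rewrite /mono /= lmul_rpath vert_vert.
  by case: eqP => [->//|_]; rewrite rpath0.
case/andP=> /eqP eu _; rewrite /mono /= lmulA -src_larr lmulA vert_vert eu.
by case: eqP => [<-|_]; rewrite ?lmul0l.
Qed.

Lemma larr_mono u e p t q : walk u p t ->
  lmul (larr e) (mono p t q) = if tgt e == u then mono (e :: p) t q else 0.
Proof.
move=> pt; rewrite -[in LHS]larr_tgt -lmulA (vert_mono _ _ pt).
by case: eqP => _ //; rewrite lmul0r.
Qed.

Lemma lstar_mono_cons u e f p t q : walk u (f :: p) t ->
  lmul (lstar e) (mono (f :: p) t q) = if e == f then mono p t q else 0.
Proof.
case/andP=> _ pt; rewrite /mono /= lmulA lstar_larr.
case: eqP => [->|_]; last exact: lmul0l.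
by rewrite (vert_mono _ _ pt) eqxx.
Qed.

Lemma lstar_mono_nil e t q :
  lmul (lstar e) (mono [::] t q) =
    if src e == t then mono [::] (tgt e) (rcons q e) else 0.
Proof.
rewrite /mono /= lmul_rpath -[in LHS]lstar_src -lmulA vert_vert.
case: eqP => [_|_]; last by rewrite lmul0r rpath0.
by rewrite lstar_src -[in LHS]tgt_lstar /rpath foldr_rcons.
Qed.

Lemma mono_rcons p q e : (forall f, src f = src e -> f = e) ->
  mono (rcons p e) (tgt e) (rcons q e) = mono p (src e) q.
Proof.
move=> eu; rewrite /mono /lpath foldr_rcons /rpath foldr_rcons.
by rewrite -/(rpath _ _) lmul_rpath lmulA larr_tgt larr_lstar.
Qed.

(** As long as the pair is not reduced, (CK2) at a vertex emitting a single arrow removes the common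
    last arrow; [p] gets shorter each time. *)
Lemma mono_reduced u w p t q : walk u p t -> walk w q t ->
  exists p' q' t', [/\ walk u p' t', walk w q' t', reduced p' q',
    (size p' + size q' <= size p + size q)%N & mono p t q = mono p' t' q'].
Proof.
have [n] := ubnP (size p); elim: n p q t => // n IHn p q t pn pt qt.
have [pq|] := pselect (reduced p q); first by exists p, q, t.
move/existsNP => [p1 /existsNP[q1 /existsNP[e /not_implyP[pE /not_implyP[qE nf]]]]].
subst p q; rewrite !walk_rcons in pt qt.
case/andP: pt => pt /eqP et; case/andP: qt => qt _; subst t.
have eu f : src f = src e -> f = e.
  by move=> fe; apply/eqP/negPn/negP => nfe; apply: nf; exists f.
rewrite size_rcons ltnS in pn.
have [p' [q' [t' [pt' qt' red le E]]]] := IHn p1 q1 (src e) pn pt qt.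
exists p', q', t'; split=> //; last by rewrite -E mono_rcons.
by rewrite !size_rcons addSn addnS; apply: leqW; apply: leqW.
Qed.
End LeavittMonomials.

(** The functions are sorted by support: there are at most [2 ^ #|J|] supports, and each admissible
    one carries at most [n.+1 ^ d] functions. *)
Lemma card_small_support (J : finType) n d :
  (#|[set h : {ffun J -> 'I_n.+1} | #|[set x | h x != ord0]%SET| <= d]%SET|
    <= 2 ^ #|J| * n.+1 ^ d)%N.
Proof.
pose S (h : {ffun J -> 'I_n.+1}) := [set x | h x != ord0]%SET.
rewrite -sum1_card (partition_big S predT) //=.
apply: leq_trans (_ : (\sum_(X : {set J}) n.+1 ^ d <= _)%N); last first.
  by rewrite sum_nat_const -cardsT -powersetT card_powerset cardsT.
apply: leq_sum => X _; rewrite sum1_card.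
have [Xd|Xd] := leqP #|X| d; last first.
  rewrite eq_card0 // => h; rewrite -topredE /= inE.
  by apply/negP => /andP[hd /eqP hX]; rewrite -/(S h) hX leqNgt Xd in hd.
apply: leq_trans (_ : #|pffun_on ord0 X (predT : pred 'I_n.+1)| <= _)%N.
  apply/subset_leq_card/fintype.subsetP => h /andP[_ /eqP hX].
  apply/pffun_onP; split=> //; apply/supportP => x; rewrite -hX inE.
  by move/negPn/eqP.
by rewrite card_pffun_on card_ord leq_pexp2l.
Qed.

(** * Upper bound: spanning by reduced monomials *)

Section LeavittSpan.
Local Open Scope classical_set_scope.
Variables (F : fieldType) (G : digraph).
Notation L := (leavitt F G).
Implicit Types (u v w t : vertex G) (e f g : arrow G) (p q : seq (arrow G)).
Implicit Types (x y : L).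

Definition leavitt_gen (i : vertex G + (arrow G + arrow G)) : L :=
  match i with inl v => lvert F v | inr (inl e) => larr F e | inr (inr e) => lstar F e end.

Definition leavitt_frame : set L := lspan (range leavitt_gen).

Lemma frame_gen i : leavitt_frame (leavitt_gen i).
Proof. by apply: sub_lspan; exists i. Qed.

Lemma gk_frame_leavitt : gk_frame leavitt_frame.
Proof.
split; first exact: findim_fin.
  by apply: lspan_sum => v _; apply: (frame_gen (inl v)).
move=> B [B1 BL BM] VB.
have B0 : 0 \in B.
  by rewrite -[0](addNr (uone : L)) -scaleN1r BL.
have BZ a x : x \in B -> a *: x \in B by move=> xB; rewrite -[a *: x]addr0 BL.
have BD x y : x \in B -> y \in B -> x + y \in B.
  by move=> xB yB; rewrite -[x]scale1r BL.
elim/pcls_ind; elim=> [[v|e|e]||a IHa b IHb|c a IHa|a IHa b IHb].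
- exact: VB (frame_gen (inl v)).
- exact: VB (frame_gen (inr (inl e))).
- exact: VB (frame_gen (inr (inr e))).
- exact: B0.
- by rewrite -pcls_add BD.
- by rewrite -pcls_scale BZ.
- by rewrite -lmulE; apply: BM.
Qed.

Definition monomials (R : seq (arrow G) -> seq (arrow G) -> Prop) n : set L :=
  [set x | exists u w p t q, [/\ walk u p t, walk w q t, R p q,
    (size p + size q <= n)%N & x = mono F p t q]].

(** A star meeting an arrow collapses by (CK1), so a generator turns a monomial into zero or into
    one monomial with at most one more letter. *)
Lemma gen_monomials n i x : monomials (fun _ _ => True) n x ->
  lspan (monomials (fun _ _ => True) n.+1) (lmul (leavitt_gen i) x).
Proof.
move=> [u [w [p [t [q [pt qt _ le ->]]]]]]; case: i => [v|[e|e]] /=.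
- rewrite (vert_mono _ _ _ pt); case: ifP => _; last exact: lspan0.
  by apply: sub_lspan; exists u, w, p, t, q; split=> //; apply: leqW.
- rewrite (larr_mono _ _ _ pt); case: eqP => [eu|_]; last exact: lspan0.
  by apply: sub_lspan; exists (src e), w, (e :: p), t, q; split; rewrite //= eqxx eu.
case: p pt le => [|f p] pt le.
  rewrite lstar_mono_nil; case: eqP => [et|_]; last exact: lspan0.
  apply: sub_lspan; exists (tgt e), w, [::], (tgt e), (rcons q e); split=> //.
  - exact: eqxx.
  - by rewrite walk_rcons et qt eqxx.
  - by rewrite size_rcons.
rewrite (lstar_mono_cons _ _ _ pt); case: eqP => [_|_]; last exact: lspan0.
case/andP: pt => _ pt; apply: sub_lspan; exists (tgt f), w, p, t, q; split=> //.
by apply: leq_trans (leqW (ltnW le)).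
Qed.

Lemma powspan_monomials n :
  powspan leavitt_frame n `<=` lspan (monomials (fun _ _ => True) n).
Proof.
move: n; apply: powspan_ind => [n|n a x y X Y||n a x Va X].
- exact: lspan0.
- by apply: lspanD => //; apply: lspanZ.
- apply: lspan_sum => v _; apply: sub_lspan; exists v, v, [::], v, [::].
  by split; rewrite //= eqxx.
- apply: lspan_mul Va X => _ y [i _ <-] Y; exact: gen_monomials.
Qed.

Lemma powspan_reduced n :
  powspan leavitt_frame n `<=` lspan (monomials (@reduced G) n).
Proof.
move=> x /powspan_monomials; apply: lspan_mono => _ [u [w [p [t [q [pt qt _ le ->]]]]]].
have [p' [q' [t' [pt' qt' red le' E]]]] := mono_reduced F pt qt.
by exists u, w, p', t', q'; split=> //; apply: leq_trans le' le.
Qed.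

(** The extra factor is the vertex [t] in the middle. *)
Lemma mono_frame p t q :
  powspan leavitt_frame (size p + (size q).+1) (mono F p t q).
Proof.
elim: p => [|e p IHp]; last first.
  rewrite /= addSn -add1n; apply: powspan_mul => //.
  exact/powspan1/(frame_gen (inr (inl e))).
elim: q => [|e q IHq]; first by apply/powspan1/(frame_gen (inl t)).
rewrite /= add0n -[X in powspan _ X]addn1; apply: powspan_mul => //.
exact/powspan1/(frame_gen (inr (inr e))).
Qed.

Hypothesis dj : disjoint_cycles G.

Section Code.
Variable n : nat.

Definition cycle_index : finType := ({set arrow G} + {set arrow G})%type.
Definition code_type : finType := (vertex G * vertex G * ({set arrow G} * {set arrow G}) *
  {ffun cycle_index -> 'I_n.+1})%type.

Definition cycle_count C p := if C \in cycles G then count (mem C) p else 0%N.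

(** For walks of length at most [n] every count is below [n.+1], so [inord] loses nothing. *)
Definition code u p w q : code_type :=
  (u, w, ([set e in p]%SET, [set e in q]%SET),
   [ffun i => inord (match i with inl C => cycle_count C p | inr C => cycle_count C q end)]).

Lemma cycle_count_le C p : (size p <= n)%N -> (cycle_count C p < n.+1)%N.
Proof.
rewrite /cycle_count ltnS => pn; case: ifP => // _.
exact: leq_trans (count_size _ _) pn.
Qed.

Lemma code_inj u p w q t u' p' w' q' t' :
  walk u p t -> walk w q t -> walk u' p' t' -> walk w' q' t' ->
  (size p + size q <= n)%N -> (size p' + size q' <= n)%N ->
  code u p w q = code u' p' w' q' -> [/\ p = p', q = q' & t = t'].
Proof.
move=> pt qt pt' qt' le le' [uu' ww' /setP pp' /setP qq' /ffunP cE].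
subst u' w'.
have [pn qn] : (size p <= n /\ size q <= n)%N by lia.
have [pn' qn'] : (size p' <= n /\ size q' <= n)%N by lia.
have pE : p = p'.
  apply: (walk_code_inj dj pt pt'); split=> [e _|C CC].
    by have := pp' e; rewrite !inE.
  have := cE (inl C); rewrite !ffunE => /(congr1 val) /=.
  by rewrite !inordK ?cycle_count_le // /cycle_count CC.
have qE : q = q'.
  apply: (walk_code_inj dj qt qt'); split=> [e _|C CC].
    by have := qq' e; rewrite !inE.
  have := cE (inr C); rewrite !ffunE => /(congr1 val) /=.
  by rewrite !inordK ?cycle_count_le // /cycle_count CC.
split=> //; rewrite -pE in pt'; move: pt pt'; clear.
by elim: p u => [|e p IHp] u /=; [move=> /eqP<- /eqP|case/andP=> _ pt /andP[_]; apply: IHp].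
Qed.

Definition small_codes : {set code_type} :=
  [set c : code_type | (#|[set i | (c.2 : {ffun cycle_index -> 'I_n.+1}) i
    != ord0]%SET| <= digraph_height G)%N]%SET.

Lemma code_small u p w q t : walk u p t -> walk w q t -> reduced p q ->
  (size p + size q <= n)%N -> code u p w q \in small_codes.
Proof.
move=> pt qt red le; rewrite inE /=.
apply: leq_trans (reduced_cycles_met dj pt qt red).
pose S : {set cycle_index} := (@inl _ _ @: cycles_met p :|: @inr _ _ @: cycles_met q)%SET.
apply: (@leq_trans #|S|); last first.
  apply: leq_trans (leq_card_setU _ _).1 _.
  by rewrite !card_imset //; [apply: inr_inj|apply: inl_inj].
apply/subset_leq_card/fintype.subsetP => i; rewrite inE ffunE.
have [pn qn] : (size p <= n /\ size q <= n)%N by lia.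
rewrite -val_eqE /=.
case: i => C; rewrite inordK ?cycle_count_le // /cycle_count; case: ifP => // CC cn.
  by apply/finset.setUP; left; apply/imset_f; rewrite in_cycles_met CC has_count lt0n.
by apply/finset.setUP; right; apply/imset_f; rewrite in_cycles_met CC has_count lt0n.
Qed.

Lemma card_small_codes : (#|small_codes| <=
  #|{: vertex G * vertex G * ({set arrow G} * {set arrow G})}| *
  2 ^ #|cycle_index| * n.+1 ^ digraph_height G)%N.
Proof.
rewrite -mulnA; apply: leq_trans (leq_mul (leqnn _) (@card_small_support cycle_index n _)).
rewrite -cardsT -cardsX; apply/subset_leq_card/fintype.subsetP => -[a h].
by rewrite !inE.
Qed.

Lemma ldim_powspan_le : (ldim (powspan leavitt_frame n) <= #|small_codes|)%N.
Proof.
(* Pairs with the same code give the same monomial by [code_inj]; a code of no pair is decoded to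
   0. *)
have decodeP (c : code_type) : exists x : L, forall u p w q t, walk u p t ->
    walk w q t -> (size p + size q <= n)%N -> code u p w q = c -> x = mono F p t q.
  have [[u [p [w [q [t [pt qt le cE]]]]]]|nc] := pselect (exists u p w q t,
    [/\ walk u p t, walk w q t, (size p + size q <= n)%N & code u p w q = c]).
    exists (mono F p t q) => u' p' w' q' t' pt' qt' le' cE'.
    by have [-> -> ->] := code_inj pt qt pt' qt' le le' (etrans cE (esym cE')).
  by exists 0 => u p w q t pt qt le cE; case: nc; exists u, p, w, q, t.
have [decode {}decodeP] := boolp.choice decodeP.
have -> : #|small_codes| = #|{: {c : code_type | c \in small_codes}}| by rewrite card_sig.
apply: (@ldim_le _ _ _ (fun c => decode (val c))).
  by apply: findim_powspan; have [] := gk_frame_leavitt.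
move=> x /powspan_reduced; apply: lspan_mono => _ [u [w [p [t [q [pt qt red le ->]]]]]].
exists (exist (fun c => c \in small_codes) _ (code_small pt qt red le)) => //=.
exact: (decodeP _ u p w q t).
Qed.

End Code.
End LeavittSpan.

(** * Independence of monomials *)

Section Representation.
Variables (F : fieldType) (G : digraph).
Notation L := (leavitt F G).
Notation tm := (term F (generator G)).
Implicit Types (u v w t : vertex G) (e f g : arrow G) (p q : seq (arrow G)).
Implicit Types (x y : L) (a b c : tm).

(* Boundary paths with an integer degree: without the degree, a closed walk at a
   terminal vertex would act as the identity. *)
Definition point : Type := ((nat -> letter G) * int)%type.
Implicit Types (phi psi : point -> F) (s : point).

Definition stail (xi : nat -> letter G) := fun n => xi n.+1.

(** Functions are transported along paths: [arr_act e] moves the value at (xi, d), for xi starting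
    at [tgt e], to (e xi, d + 1), and [star_act e] moves it back. *)
Definition vert_act v phi s : F := if `[< boundary v s.1 >] then phi s else 0.
Definition arr_act e phi s : F :=
  if `[< boundary (src e) s.1 /\ s.1 0%N = inl e >]
  then phi (stail s.1, s.2 - 1) else 0.
Definition star_act e phi s : F :=
  if `[< boundary (tgt e) s.1 >] then phi (scons e s.1, s.2 + 1) else 0.

Fixpoint act a phi s : F := match a with
  | TGen (Vert v) => vert_act v phi s
  | TGen (Arr e) => arr_act e phi s
  | TGen (Star e) => star_act e phi s
  | TZero => 0
  | TAdd a b => act a phi s + act b phi s
  | TScale k a => k * act a phi s
  | TMul a b => act a (act b phi) s
  end.

Lemma act_ext a phi psi : phi =1 psi -> act a phi =1 act a psi.
Proof. by move=> /funext->. Qed.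

Lemma act_linear a k phi psi s :
  act a (fun s => k * phi s + psi s) s = k * act a phi s + act a psi s.
Proof.
elim: a phi psi s => [[v|e|e]||a IHa b IHb|l a IHa|a IHa b IHb] phi psi s /=.
- by rewrite /vert_act; case: ifP => // _; rewrite mulr0 addr0.
- by rewrite /arr_act; case: ifP => // _; rewrite mulr0 addr0.
- by rewrite /star_act; case: ifP => // _; rewrite mulr0 addr0.
- by rewrite mulr0 addr0.
- by rewrite IHa IHb mulrDr addrACA.
- by rewrite IHa mulrDr mulrCA.
- by rewrite (act_ext _ (IHb phi psi)) IHa.
Qed.

Lemma act_add a phi psi s :
  act a (fun s => phi s + psi s) s = act a phi s + act a psi s.
Proof.
rewrite -[act a phi s]mul1r -act_linear.
by congr (act a _ s); apply/funext => s'; rewrite mul1r.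
Qed.

Lemma act_scale a k phi s : act a (fun s => k * phi s) s = k * act a phi s.
Proof.
have act0 : act a (fun=> 0) s = 0.
  by apply: (addrI (act a (fun=> 0) s)); rewrite -act_add !addr0.
rewrite -[RHS]addr0 -[X in _ = _ + X]act0 -act_linear.
by congr (act a _ s); apply/funext => s'; rewrite addr0.
Qed.

Lemma scons_stail e (xi : nat -> letter G) : xi 0%N = inl e -> xi = scons e (stail xi).
Proof. by move=> x0; apply/funext => -[|n]. Qed.

Lemma star_arr e phi s :
  star_act e (arr_act e phi) s = vert_act (tgt e) phi s.
Proof.
rewrite /star_act /vert_act; case: asboolP => // bs.
rewrite /arr_act asboolT /= ?addrK; first by case: s {bs}.
by split=> //; apply/boundary_scons.
Qed.

Lemma act_rel a b : leavitt_rel a b -> forall phi, act a phi =1 act b phi.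
Proof.
case=> {a b} [v w|e|e|e|e|e f|v vs] phi s.
- rewrite /= /vert_act; case: eqP => [->|vw] /=; first by rewrite /vert_act; case: asboolP.
  case: asboolP => // bv; case: asboolP => // bw.
  by case: vw; apply: boundary_src bv bw.
- rewrite /= /vert_act; case: asboolP => // ns.
  by rewrite /arr_act asboolF // => -[].
- rewrite /= /arr_act; case: asboolP => // -[bs /scons_stail sE].
  rewrite /vert_act asboolT //=; move: bs; rewrite {1}sE.
  by case/boundary_scons.
- by rewrite /= /vert_act /star_act; case: asboolP.
- rewrite /= /star_act; case: asboolP => // bs.
  by rewrite /vert_act asboolT //=; apply/boundary_scons.
- rewrite /=; case: eqP => [<-|ef]; first exact: star_arr.
  rewrite /= /star_act; case: ifP => // _.
  by rewrite /arr_act asboolF //= => -[_ [/ef]].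
have sumE (l : seq (arrow G)) : act (foldr (@TAdd F (generator G)) TZero
     [seq TMul (TGen (Arr e)) (TGen (Star e)) | e <- l]) phi s =
   \sum_(e <- l) arr_act e (star_act e phi) s.
  by elim: l => [|e l IHl]; rewrite ?big_nil //= big_cons -IHl.
rewrite {}sumE big_filter big_enum_cond /= /vert_act.
case: asboolP => [bs|nbs]; last first.
  by rewrite big1 // => e /eqP ev; rewrite /arr_act asboolF // ev => -[].
(* A boundary path from a vertex that is not a sink begins with exactly one arrow, so one term of
   the (CK2) sum survives. *)
have [e ev [eta sE be]] := boundary_head bs vs.
rewrite (bigD1 e) /=; last by rewrite ev.
rewrite big1 => [|f /andP[_ fe]]; last first.
  rewrite /arr_act asboolF // => -[_]; rewrite sE => -[ef].
  by rewrite ef eqxx in fe.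
rewrite addr0 /arr_act asboolT; last by split; rewrite ?ev // sE.
have etaE : stail s.1 = eta by rewrite sE; apply/funext.
by rewrite etaE /star_act asboolT //= -sE subrK; case: s {bs sE etaE}.
Qed.

Lemma act_congr a b : congr (@leavitt_rel F G) a b -> forall phi, act a phi =1 act b phi.
Proof.
elim=> {a b} /=.
- by move=> a b /act_rel.
- by [].
- by move=> a b _ IH phi s; rewrite IH.
- by move=> b a c _ IH1 _ IH2 phi s; rewrite IH1 IH2.
- by move=> a a' b b' _ IH1 _ IH2 phi s; rewrite IH1 IH2.
- by move=> k a a' _ IH phi s; rewrite IH.
- by move=> a a' b b' _ IH1 _ IH2 phi s; rewrite IH1; apply: act_ext.
- by move=> a b c phi s; rewrite addrA.
- by move=> a b phi s; rewrite addrC.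
- by move=> a phi s; rewrite add0r.
- by move=> a phi s; rewrite mulN1r addNr.
- by move=> k l a phi s; rewrite mulrA.
- by move=> a phi s; rewrite mul1r.
- by move=> k a b phi s; rewrite mulrDr.
- by move=> k l a phi s; rewrite mulrDl.
- by [].
- by [].
- by move=> a b c phi s; rewrite act_add.
- by [].
- by move=> k a b phi s; rewrite act_scale.
Qed.

Definition Act x := act (prep x).

Lemma ActE a : Act (pcls (@leavitt_rel F G) a) = act a.
Proof. by apply/funext => phi; apply/funext; apply: act_congr (prep_cls _ _) phi. Qed.

Lemma ActD x y phi s : Act (x + y) phi s = Act x phi s + Act y phi s.
Proof. by elim/pcls_ind: x => a; elim/pcls_ind: y => b; rewrite pcls_add !ActE. Qed.

Lemma ActZ k x phi s : Act (k *: x) phi s = k * Act x phi s.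
Proof. by elim/pcls_ind: x => a; rewrite pcls_scale !ActE. Qed.

Lemma ActM x y phi : Act (lmul x y) phi = Act x (Act y phi).
Proof. by elim/pcls_ind: x => a; elim/pcls_ind: y => b; rewrite lmulE !ActE. Qed.

Lemma Act0 phi s : Act 0 phi s = 0.
Proof. by apply: (addrI (Act 0 phi s)); rewrite -ActD !addr0. Qed.

Lemma Act_sum (I : finType) (k : I -> F) (x : I -> L) phi s :
  Act (\sum_i k i *: x i) phi s = \sum_i k i * Act (x i) phi s.
Proof.
elim/big_rec2: _ => [|i y z _ <-]; first exact: Act0.
by rewrite ActD ActZ.
Qed.

Lemma Act_rpath w q t phi s : walk w q t ->
  Act (rpath q (lvert F t)) phi s =
    if `[< boundary t s.1 >] then phi (prepend q s.1, s.2 + (size q)%:Z) else 0.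
Proof.
elim: q w phi => [|e q IHq] w phi /=.
  by rewrite ActE /= /vert_act addr0; case: s.
case/andP=> _ qt; rewrite ActM (IHq _ _ qt); case: asboolP => // bs.
rewrite ActE /= /star_act asboolT /=; last exact: boundary_prepend qt bs.
by rewrite -addrA -PoszD addn1.
Qed.

(** As [omega] is the only boundary path at [t], the monomial merely moves values from q omega to p
    omega and raises the degree by |p| - |q|. *)
Lemma Act_mono u w p t q omega phi s : walk u p t -> walk w q t ->
  terminal t omega -> Act (mono F p t q) phi s =
    if `[< s.1 = prepend p omega >]
    then phi (prepend q omega, s.2 - (size p)%:Z + (size q)%:Z) else 0.
Proof.
move=> pt qt om; elim: p u s pt => [|e p IHp] u s /=.
  move=> _; rewrite subr0 (Act_rpath _ _ qt) (propext (om s.1)).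
  by case: asboolP => // ->.
case/andP=> _ pt; rewrite ActM ActE /= /arr_act.
have bp : boundary (tgt e) (prepend p omega).
  by apply: boundary_prepend pt _; apply/om.
case: asboolP => [[bs s0]|ns]; last first.
  rewrite asboolF // => sE; apply: ns; rewrite sE; split=> //.
  exact/boundary_scons.
rewrite (IHp _ _ pt) /=.
have -> : (stail s.1 = prepend p omega) = (s.1 = scons e (prepend p omega)).
  apply/propext; split=> [<-|->]; first exact: scons_stail.
  exact/funext.
case: asboolP => // _; congr (phi (_, _ + _)).
by rewrite -addrA -opprD -PoszD.
Qed.

Lemma prepend_terminal t p omega : terminal t omega -> walk t p t ->
  prepend p omega = omega.
Proof. by move=> om pt; apply/om/(boundary_prepend pt)/om. Qed.

(** The two paths determine the two walks, and the degree determines the power of [z] when [z] is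
    not empty; otherwise [m = 0] and only the power 0 occurs. *)
Lemma walk_mono_indep (I : finType) (P : I -> seq (arrow G)) v t omega z m :
  terminal t omega -> walk t z t -> (0 < size z)%N || (m == 0)%N ->
  (forall i, walk v (P i) t) -> injective (fun i => prepend (P i) omega) ->
  forall k : I * I * 'I_m.+1 -> F,
    \sum_i k i *: mono F (P i.1.1 ++ repeat z i.2) t (P i.1.2) = 0 ->
    forall i, k i = 0.
Proof.
move=> om zt zm Pt Pinj k k0 [[i j] l].
(* The test function is supported at one point, and the degree of [s] is such that only the monomial
   of index (i, j, l) carries that point to [s]. *)
pose phi (s : point) : F := (`[< s = (prepend (P j) omega, 0) >])%:R.
pose s : point := (prepend (P i) omega,
  (size (P i))%:Z + (l * size z)%:Z - (size (P j))%:Z).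
have := Act_sum k (fun i => mono F (P i.1.1 ++ repeat z i.2) t (P i.1.2)) phi s.
rewrite k0 Act0 => sum0; rewrite {}[LHS](_ : _ = \sum_(i' : I * I * 'I_m.+1)
   k i' * (i' == (i, j, l))%:R); last first.
  rewrite (bigD1 (i, j, l)) //= eqxx mulr1 big1 ?addr0 // => i' /negPf->.
  by rewrite mulr0.
rewrite [RHS]sum0; apply: eq_bigr => -[[i' j'] l'] _ /=; congr (_ * _).
have tz := walk_repeat l' zt.
rewrite (Act_mono _ _ (walk_cat (Pt i') tz) (Pt j') om) /=.
rewrite prepend_cat (prepend_terminal om tz) size_cat size_repeat /s /=.
case: asboolP => [/Pinj ii|ni]; last first.
  by case: eqP => // -[ii _ _]; case: ni; rewrite ii.
rewrite -{}ii /phi; congr (_%:R : F); congr nat_of_bool.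
apply/eqP/asboolP => [[-> ->]|[/Pinj <- E]]; first by congr (_, _); lia.
congr (_, _, _); apply: val_inj => /=.
have {E} : (l' * size z = l * size z)%N by lia.
case/orP: zm => [z0 /eqP|/eqP m0 _]; first by rewrite eqn_pmul2r // => /eqP.
by move: l l' {s sum0 tz}; rewrite m0 => l l'; rewrite !ord1.
Qed.

End Representation.

(** * Lower bound: independent monomials along a chain of cycles *)

Section LowerBound.
Variables (F : fieldType) (G : digraph).
Hypothesis dj : disjoint_cycles G.

Let mono_size_bound (a b c l m z : nat) : (l <= m)%N ->
  (a <= c * m.+1)%N -> (b <= c * m.+1)%N ->
  (a + l * z + b.+1 <= (2 * c + z + 1) * m.+1)%N.
Proof. nia. Qed.

Lemma ldim_powspan_ge : (0 < digraph_height G)%N -> exists c, forall m,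
  (m.+1 ^ digraph_height G <= ldim (powspan (@leavitt_frame F G) (c * m.+1)))%N.
Proof.
move=> h0; have [|C CC hC] := @eq_bigmax_cond _ (mem (cycles G))
  (fun C => height (inr C : node G)).
  rewrite lt0n; apply: contraTneq h0 => /eqP; rewrite cards_eq0 => /eqP C0.
  by rewrite /digraph_height C0 big_set0.
have [v vC] : exists v, v \in cycle_vertices C.
  have /leads_refl/leadsP[v [_ [vC _ _]]] : (inr C : node G) \in nodes G by rewrite nodesE.
  by exists v.
have [|t [om [z [k [c [b [tom zt bz hE H]]]]]]] := walk_family dj (x := inr C) _ vC.
  by rewrite nodesE.
have hh : digraph_height G = (2 * k + b)%N by rewrite -hE -hC.
exists (2 * c + size z + 1)%N => m.
have [I [P [cI Pt Ps Pinj]]] := H m.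
(* The height is [2 * k + b]: each of the two walks contributes [k] to the exponent, and the powers
   of [z] contribute 1 when the chain ends in a cycle. If it ends in a sink, only the power 0 is
   kept. *)
pose M := if b then m else 0%N.
have -> : (m.+1 ^ digraph_height G = #|{: I * I * 'I_M.+1}|)%N.
  rewrite !card_prod card_ord cI hh expnD mul2n -addnn expnD /M.
  by case: (b); rewrite ?expn1.
have [fd W1 _] := gk_frame_leavitt F G.
apply: (ldim_ge_fin (findim_powspan _ fd)
  (b := fun i : I * I * 'I_M.+1 => mono F (P i.1.1 ++ repeat z i.2) t (P i.1.2))).
  apply: (walk_mono_indep tom zt) => //.
  by rewrite /M; case: (b) bz => [-> //|_]; rewrite orbT.
move=> [[i j] l]; apply: powspan_le (mono_frame _ _ _ _) => //=.
rewrite size_cat size_repeat.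
have ML : (M <= m)%N by rewrite /M; case: (b).
have lm : (l <= m)%N by apply: leq_trans ML; rewrite -ltnS.
exact: mono_size_bound lm (Ps i) (Ps j).
Qed.

End LowerBound.

Theorem theorem24 (R : realType) (F : fieldType) (G : digraph) :
  disjoint_cycles G ->
  has_GKdim (leavitt F G) ((digraph_height G)%:R%:E : \bar R).
Proof.
move=> dj; pose K := (#|{: vertex G * vertex G * ({set arrow G} * {set arrow G})}| *
  2 ^ #|cycle_index G|)%N.
have up n : (ldim (powspan (@leavitt_frame F G) n) <= K * n.+1 ^ digraph_height G)%N.
  exact: leq_trans (ldim_powspan_le F dj n) (card_small_codes G n).
have [fW W1 _] := gk_frame_leavitt F G.
have growth := @has_GKdim_growth R F (leavitt F G) _ (digraph_height G) _
  (@gk_frame_leavitt F G).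
(* For height 0 the lower bound required by [growth] is vacuous. *)
have [h0|h0] := posnP (digraph_height G).
  by apply: (growth K) up; rewrite h0.
have [c lo] := ldim_powspan_ge F dj h0.
(* [growth] uses one constant for both bounds; enlarging either constant only weakens its bound. *)
apply: (growth (maxn K c)) => [_ m|n]; last first.
  by apply: leq_trans (up n) _; rewrite leq_mul2r leq_maxl orbT.
apply: leq_trans (lo m) (ldim_mono _ _ (powspan_le W1 _)).
- exact: findim_powspan.
- exact: findim_powspan.
- by rewrite leq_mul2r leq_maxr orbT.
Qed.
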